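(* Let $\lambda$ be a ballot path ending at height $h$, let $N_D(\lambda)$ be the number of $D$ steps of $\lambda$, and let $\tilde\lambda=\lambda D^h$ (a Dyck path). Then $$P^{III}_{\lambda,\ast}=P^{\mathrm{Dyck}}_{\tilde\lambda}\cdot\prod_{i=1}^{N_D(\lambda)}(1+q^{i-1}t).$$
   Context: Paths: a path of length $N$ is a word in $\{U,D\}$ identified with the lattice path from $(0,0)$ with steps $U=(1,1)$, $D=(1,-1)$; $\lambda(x)$ is its height at $x$. A ballot path never goes below height $0$; a Dyck path is a ballot path ending at height $0$. Boxes: for integers $a,b$ with $a+b$ odd, the box centered at $(a,b)$ is the closed square with vertices $(a\pm1,b),(a,b\pm1)$. Dyck tilings: for a Dyck path $\nu$ of length $2n$, $Y(\nu)$ is the set of boxes centered at $(a,b)$ with $b-1\ge\nu(a)$, $b+1\le a$, $b+1\le 2n-a$; for a Dyck path $\mu$ weakly above $\nu$, $\nu/\mu=Y(\nu)\setminus Y(\mu)$. A Dyck tile is a nonempty set of boxes whose centers, listed left to right $c_0,\dots,c_{2k}$, satisfy $c_{i+1}-c_i\in\{(1,\pm1)\}$, none lower than $c_0$, $c_{2k}$ at the height of $c_0$. A Dyck tiling is a partition of $\nu/\mu$ into Dyck tiles; it is cover-inclusive if for every tile $\tau$, $\tau-(0,2)$ either lies entirely below $\nu$ (each translated box has its top vertex at or below $\nu$) or is contained in a single tile. $\mathrm{art}=(\#\text{boxes}+\#\text{tiles})/2$ and $P^{\mathrm{Dyck}}_\nu=\sum q^{\mathrm{art}(D)}$ over all cover-inclusive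 Dyck tilings $D$ of $\nu/\mu$, over all Dyck paths $\mu$ weakly above $\nu$. Ballot tilings: for a path $\lambda$ of length $N$, the shifted diagram $S(\lambda)$ is the set of boxes centered at $(a,b)$ with $1\le a\le N$, $b-1\ge\lambda(a)$ and $b+1\le a$; boxes with $a=N$ are anchor boxes. For a path $\mu$ of length $N$ weakly above $\lambda$, $\lambda/\mu=S(\lambda)\setminus S(\mu)$. A ballot tile of length $(2n,n')$ is a set of $2n+n'+1$ boxes whose centers listed left to right $c_0,\dots,c_{2n+n'}$ satisfy $c_{i+1}-c_i\in\{(1,\pm1)\}$, none lower than $c_0$, and $c_{2n+n'}$ exactly $n'$ higher than $c_0$ (Dyck tiles are those with $n'=0$). A ballot tiling of $\lambda/\mu$ is a partition into ballot tiles such that every tile with $n'\ge1$ has its rightmost box an anchor box; it is cover-inclusive if for every tile $\tau$, $\tau-(0,2)$ either lies entirely below $\lambda$ or is contained in a single tile. Type BIII weights: a tile of length $(2n,n')$ has $\mathrm{art}=n$ if its rightmost box is an anchor box and $\mathrm{art}=n+1$ otherwise; $\mathrm{art}(B)$ of a tiling is the sum over tiles, and $\mathrm{tiles}_2(B)$ is the number of tiles whose rightmost box is an anchor box. $P^{III}_{\lambda,\ast}=\sum q^{\mathrm{art}(B)}t^{\mathrm{tiles}_2(B)}$ over all cover-inclusive ballot tilings $B$ of $\lambda/\mu$, over all paths $\mu$ of length $N$ weakly above $\lambda$. *)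

(* Defs.v *)
From HB Require Import structures.
From mathcomp Require Import all_boot all_order all_algebra.
Set Implicit Arguments. Unset Strict Implicit. Unset Printing Implicit Defensive.
Import Order.TTheory GRing.Theory Num.Theory.

(* Paths: seq bool, true = U = (1,1), false = D = (1,-1). *)
Definition height (p : seq bool) (x : nat) : int :=
  (count id (take x p))%:Z - (count negb (take x p))%:Z.

Definition ballot (p : seq bool) : bool :=
  [forall x : 'I_(size p).+1, (0 <= height p x)%R].

Definition dyck (p : seq bool) : bool := ballot p && (height p (size p) == 0%R).

(* mu weakly above lam (same length assumed by the context) *)
Definition above (lam mu : seq bool) : bool :=
  [forall x : 'I_(size lam).+1, (height lam x <= height mu x)%R].

Definition n_D (p : seq bool) : nat := count negb p.
Definition final_height (p : seq bool) : nat := (count id p - count negb p)%N.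

(* Boxes, given by their centers (a,b); for paths of length N all relevant
   centers satisfy a <= N and b <= N. *)
Definition box (N : nat) := ('I_N.+1 * 'I_N.+1)%type.
Definition ctr N (x : box N) : nat * nat := (nat_of_ord x.1, nat_of_ord x.2).

Definition inS (lam : seq bool) (c : nat * nat) : bool :=
  [&& 1 <= c.1 <= size lam, odd (c.1 + c.2),
      (height lam c.1 + 1 <= (c.2)%:Z)%R & c.2 + 1 <= c.1].

Definition inY (nu : seq bool) (c : nat * nat) : bool :=
  [&& odd (c.1 + c.2), (height nu c.1 + 1 <= (c.2)%:Z)%R,
      c.2 + 1 <= c.1 & c.2 + 1 + c.1 <= size nu].

Definition skewS (lam mu : seq bool) : {set box (size lam)} :=
  [set x | inS lam (ctr x) && ~~ inS mu (ctr x)].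

Definition skewY (nu mu : seq bool) : {set box (size nu)} :=
  [set x | inY nu (ctr x) && ~~ inY mu (ctr x)].

Definition centers N (T : {set box N}) : seq (nat * nat) :=
  sort (fun c d : nat * nat => c.1 <= d.1) [seq ctr x | x <- enum T].

Definition tstep (c d : nat * nat) : bool :=
  (d.1 == c.1 + 1) && ((d.2 == c.2 + 1) || (d.2 + 1 == c.2)).

Definition ballot_tile N (T : {set box N}) : bool :=
  match centers T with
  | [::] => false
  | c0 :: s => path tstep c0 s && all (fun c => c0.2 <= c.2) s
  end.

Definition tile_rise N (T : {set box N}) : nat :=
  match centers T with
  | [::] => 0
  | c0 :: s => ((last c0 s).2 - c0.2)%N
  end.

Definition dyck_tile N (T : {set box N}) : bool :=
  ballot_tile T && (tile_rise T == 0).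

(* n where the tile has 2n + n' + 1 boxes *)
Definition tile_half N (T : {set box N}) : nat := ((#|T| - 1 - tile_rise T) %/ 2)%N.

Definition rightmost N (T : {set box N}) : nat * nat := last (0, 0) (centers T).

Definition anchored N (T : {set box N}) : bool := (rightmost T).1 == N.

Definition cover_inclusive N (p : seq bool) (P : {set {set box N}}) : bool :=
  [forall tau in P,
     [forall x in tau, ((ctr x).2%:Z - 1 <= height p (ctr x).1)%R]
     || [exists tau' in P, [forall x in tau, exists y in tau',
            ((ctr y).1 == (ctr x).1) && ((ctr y).2 + 2 == (ctr x).2)]]].

Definition dyck_tiling (nu mu : seq bool) (P : {set {set box (size nu)}}) : bool :=
  [&& partition P (skewY nu mu), [forall tau in P, dyck_tile tau]
    & cover_inclusive nu P].

Definition ballot_tiling (lam mu : seq bool) (P : {set {set box (size lam)}}) : bool :=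
  [&& partition P (skewS lam mu),
      [forall tau in P, ballot_tile tau]
    & [forall tau in P, (0 < tile_rise tau) ==> anchored tau]].

Arguments dyck_tiling : clear implicits.
Arguments ballot_tiling : clear implicits.

Definition art_dyck N (P : {set {set box N}}) : nat :=
  ((\sum_(tau in P) #|tau| + #|P|) %/ 2)%N.

Definition art_III N (P : {set {set box N}}) : nat :=
  (\sum_(tau in P) (if anchored tau then tile_half tau else (tile_half tau).+1))%N.

Definition tiles2 N (P : {set {set box N}}) : nat := #|[set tau in P | anchored tau]|.

Local Open Scope ring_scope.

Definition P_Dyck (R : comPzRingType) (q : R) (nu : seq bool) : R :=
  \sum_(mu : (size nu).-tuple bool | dyck mu && above nu mu)
    \sum_(P : {set {set box (size nu)}} | dyck_tiling nu mu P) q ^+ art_dyck P.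

Definition P_III (R : comPzRingType) (q t : R) (lam : seq bool) : R :=
  \sum_(mu : (size lam).-tuple bool | above lam mu)
    \sum_(P : {set {set box (size lam)}} |
           ballot_tiling lam mu P && cover_inclusive lam P)
      q ^+ art_III P * t ^+ tiles2 P.

(* Main.v *)
Require Import Defs.
From HB Require Import structures.
From mathcomp Require Import all_boot all_order all_algebra.
From mathcomp Require Import zify ring.
Set Implicit Arguments. Unset Strict Implicit. Unset Printing Implicit Defensive.
Import GRing.Theory.

(** Write H x for the height of lambda at x. Cover-inclusiveness forces every
    tile to be a vertical translate of a piece of lambda: it consists of the
    boxes (x, H x + 1 + 2k) for l <= x <= r, at one level k, and the tiles of
    level k + 1 are nested in those of level k. Recording, for each column x
    and each level, the left end of the tile found there turns a tiling into a
    run of states along lambda: at a U step some tiles whose left end has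
    height H x stop, and at most one level disappears; at a D step all tiles
    whose left end has height H x stop, and at most one level appears. The art
    statistic is the number of boxes in columns followed by a D step plus the
    number of tiles stopped before a U step, and tiles_2 is the size of the
    last state.

    Only the numbers m_i of left ends of height i matter for the weights. In
    the generating function in variables x_0, ..., x_v, the steps from
    height v are
      U : f(x_v) |-> ((x_v + q) f(x_v) - (y + q) f(y)) / (x_v - y),  y = q x_{v+1},
      D : f |-> (1 + x_{v-1}) f(q x_0, ..., q x_{v-1}, q x_{v-1}).
    For n = d_0 >= d_1 >= ... >= d_v >= d_{v+1} = 0, let B_d be the product
    over i and over d_{i+1} <= e < d_i of 1 + q^e x_i. Then U maps B_d to the
    sum over 0 <= k <= d_v of q^k B_(d,k), and D drops d_v and increments the
    other d_i. At x_0 = ... = x_v = t every B_d equals the product of the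
    1 + q^e t for e < d_0, and d_0 is the number of D steps read so far, so that
    P^III is this product times a factor independent of t. At t = 0 only tilings
    without anchored tiles survive, which are the Dyck tilings, and the
    trailing D steps of lambda D^h do not change the factor. *)

(** * Linear functionals and the basis B_d *)

Section ShiftOperators.
Local Open Scope ring_scope.
Variables (R : comPzRingType) (q : R).

(* The linear functional x^m |-> g m, evaluated at the product of the
   1 + q^e x for e in es. *)
Fixpoint ev (es : seq nat) (g : nat -> R) : R :=
  if es is e :: es' then ev es' (fun m => g m + q ^+ e * g m.+1) else g 0%N.

Lemma eq_ev es g g' : g =1 g' -> ev es g = ev es g'.
Proof. by elim: es g g' => [|e es IH] g g' eg //=; apply: IH => m; rewrite !eg. Qed.

Lemma evD es g g' : ev es (fun m => g m + g' m) = ev es g + ev es g'.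
Proof.
elim: es g g' => [|e es IH] g g' //=; rewrite -IH; apply: eq_ev => m.
by rewrite mulrDr addrACA.
Qed.

Lemma evZ es c g : ev es (fun m => c * g m) = c * ev es g.
Proof.
elim: es g => [|e es IH] g //=; rewrite -IH; apply: eq_ev => m.
by rewrite mulrDr mulrCA.
Qed.

(** Splitting the product makes the two exponents separate summands, as for two variables set equal.
    This is what merges blocks at a D step. *)
Lemma ev_cat es1 es2 g :
  ev (es1 ++ es2) g = ev es1 (fun a => ev es2 (fun b => g (a + b)%N)).
Proof.
elim: es1 g => [|e es1 IH] g //=; rewrite IH; apply: eq_ev => m.
by rewrite -evZ -evD; apply: eq_ev => b; rewrite addSn.
Qed.

Lemma ev_rcons es e g :
  ev (rcons es e) g = ev es g + q ^+ e * ev es (fun m => g m.+1).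
Proof.
by rewrite -cats1 ev_cat /= -evZ -evD; apply: eq_ev => m; rewrite addn0 addn1.
Qed.

(** Raising every exponent by one is the substitution x |-> q x, which scales x^m by q^m. *)
Lemma ev_shift es g : ev (map S es) g = ev es (fun m => q ^+ m * g m).
Proof.
elim: es g => [|e es IH] g /=; first by rewrite mul1r.
by rewrite IH; apply: eq_ev => m; rewrite mulrDr !exprS; ring.
Qed.

Lemma ev_exp es (t : R) : ev es (fun m => t ^+ m) = \prod_(e <- es) (1 + q ^+ e * t).
Proof.
elim: es => [|e es IH] /=; first by rewrite big_nil.
by rewrite big_cons -IH -evZ; apply: eq_ev => m; rewrite exprS; ring.
Qed.

(* The step U on the factor of B_d in x_v: [f b a] is the coefficient
   functional at x_{v+1}^b x_v^a. *)
Lemma ev_up d (f : nat -> nat -> R) :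
  ev (iota 0 d) (fun m => \sum_(i < m.+1) q ^+ i * f i (m - i)%N +
                          \sum_(i < m) q ^+ i.+1 * f i (m - i.+1)%N) =
  \sum_(k < d.+1) q ^+ k *
    ev (iota 0 k) (fun b => ev (iota k (d - k)) (fun a => f b a)).
Proof.
elim: d f => [|d IH] f.
  by rewrite /= !big_ord_recl !big_ord0 /= !addr0.
rewrite -[d.+1 in LHS]addn1 iotaD add0n cats1 ev_rcons IH.
rewrite [RHS]big_ord_recr /= subnn /=.
have -> : iota 1 d = map S (iota 0 d) by rewrite -(iotaDl 1).
rewrite ev_shift.
(* The split-off factor 1 + q^d x contributes the induction hypothesis for [f] and for [f] with its
   second argument shifted. The last terms of the two sums at [m.+1], where that argument is 0, are
   kept apart: they form the new summand k = d + 1, whose block is 1 + x times a shifted block. *)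
transitivity (\sum_(k < d.+1) q ^+ k * ev (iota 0 k) (fun b => ev (iota k (d - k)) (f b))
  + q ^+ d * (\sum_(k < d.+1) q ^+ k * ev (iota 0 k) (fun b => ev (iota k (d - k)) (fun a => f b a.+1))
    + ev (iota 0 d) (fun m => q ^+ m.+1 * (f m 0%N + f m.+1 0%N)))).
  congr (_ + _ * _). rewrite -(IH (fun b a => f b a.+1)) -evD; apply: eq_ev => m.
  rewrite [in LHS]big_ord_recr [X in _ + X]big_ord_recr /= !subnn.
  under eq_bigr => i _ do rewrite subSn -1?ltnS //.
  under [X in _ + (X + _)]eq_bigr => i _ do rewrite subSn //.
  by rewrite exprS; ring.
rewrite mulrDr addrA; congr (_ + _).
  rewrite big_distrr -big_split /=; apply: eq_bigr => k _.
  rewrite subSn -1?ltnS // -[(d - k).+1]addn1 iotaD subnKC -1?ltnS // cats1.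
  rewrite [q ^+ d * _]mulrCA -mulrDr; congr (_ * _); rewrite -[q ^+ d * _]evZ -evD.
  by apply: eq_ev => b; rewrite ev_rcons.
rewrite -!evZ; apply: eq_ev => m; rewrite expr0 !exprS; ring.
Qed.

(* As [ev], with one variable per block; the top variable x_v comes first. *)
Fixpoint mev (bl : seq (seq nat)) (F : seq nat -> R) : R :=
  if bl is es :: bl' then ev es (fun m => mev bl' (fun s => F (m :: s))) else F [::].

Lemma eq_mev bl F F' : F =1 F' -> mev bl F = mev bl F'.
Proof.
elim: bl F F' => [|es bl IH] F F' eF /=; first exact: eF.
by apply: eq_ev => m; apply: IH => s.
Qed.

Lemma mevD bl F F' : mev bl (fun s => F s + F' s) = mev bl F + mev bl F'.
Proof.
by elim: bl F F' => [|es bl IH] F F' //=; rewrite -evD; apply: eq_ev => m; rewrite IH.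
Qed.

Lemma mevZ bl c F : mev bl (fun s => c * F s) = c * mev bl F.
Proof.
by elim: bl F => [|es bl IH] F //=; rewrite -evZ; apply: eq_ev => m; rewrite IH.
Qed.

Lemma mev0 bl : mev bl (fun=> 0) = 0.
Proof.
by rewrite -[RHS](mul0r (mev bl (fun=> 0))) -mevZ; apply: eq_mev => s; rewrite mul0r.
Qed.

Lemma mev_sum bl n (F : 'I_n -> seq nat -> R) :
  mev bl (fun s => \sum_(i < n) F i s) = \sum_(i < n) mev bl (F i).
Proof.
elim: n F => [|n IH] F.
  by rewrite big_ord0 -[RHS](mev0 bl); apply: eq_mev => s; rewrite big_ord0.
rewrite big_ord_recl -IH -mevD; apply: eq_mev => s; by rewrite big_ord_recl.
Qed.

Lemma mev_shift bl F :
  mev (map (map S) bl) F = mev bl (fun s => q ^+ sumn s * F s).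
Proof.
elim: bl F => [|es bl IH] F /=; first by rewrite mul1r.
rewrite ev_shift; apply: eq_ev => m; rewrite IH -mevZ; apply: eq_mev => s.
by rewrite mulrA exprD.
Qed.

(* The exponents occurring in B_d, for the reversed list [:: d_v; ...; d_0]
   and a = 0. *)
Fixpoint blocks a ds : seq (seq nat) :=
  if ds is d :: ds' then iota a (d - a) :: blocks d ds' else [::].

Lemma map_blocks a ds : map (map S) (blocks a ds) = blocks a.+1 (map S ds).
Proof.
elim: ds a => [|d ds IH] a //=; by rewrite IH subSS (iotaDl 1).
Qed.

(** With all variables equal to t, the consecutive intervals of exponents glue to a single one. *)
Lemma mev_exp a ds (t : R) : path leq a ds ->
  mev (blocks a ds) (fun s => t ^+ sumn s) =
  \prod_(e <- iota a (last a ds - a)) (1 + q ^+ e * t).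
Proof.
elim: ds a => [|d ds IH] a /=; first by rewrite subnn big_nil.
case/andP => lead pds.
have -> : (last d ds - a = (d - a) + (last d ds - d))%N.
  suff : (d <= last d ds)%N by lia.
  elim: (ds) (d) pds => [|e l IHl] d' //= /andP[le /IHl]; exact: leq_trans.
rewrite iotaD big_cat /= subnKC // -IH // -ev_exp mulrC -evZ.
by apply: eq_ev => m; rewrite [RHS]mulrC -mevZ; apply: eq_mev => s; rewrite -exprD.
Qed.

Variable t : R.

(* Total weight of the runs along p starting from the multiplicities
   m = [:: m_v; ...; m_0]; at a U step, i is the new multiplicity at
   height v + 1. *)
Fixpoint wmult (p : seq bool) (m : seq nat) : R :=
  if p is b :: p' then
    let a := head 0%N m in let s := behead m in
    if b then
      \sum_(i < a.+1) q ^+ i * wmult p' [:: (i : nat), a - i & s]%N +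
      \sum_(i < a) q ^+ i.+1 * wmult p' [:: (i : nat), a - i.+1 & s]%N
    else
      let a' := head 0%N s in let s' := behead s in
      q ^+ sumn m * (wmult p' ((a + a')%N :: s') + wmult p' ((a + a').+1 :: s'))
  else t ^+ sumn m.

(** The factor free of t: the total coefficient collected when the steps of p act on B_d, with d_v
    at the head of [ds]. A U step chooses d_{v+1} = k. *)
Fixpoint chains (p : seq bool) (ds : seq nat) : R :=
  if p is b :: p' then
    if b then \sum_(k < (head 0%N ds).+1) q ^+ k * chains p' ((k : nat) :: ds)
    else chains p' (map S (behead ds))
  else 1.

(** Nonnegativity in the recursive form of [wmult]; v will be the number of blocks beyond the first,
    so that a D step always finds a block to merge with. *)
Fixpoint stays_nonneg (v : nat) (p : seq bool) : bool :=
  if p is b :: p' then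
    if b then stays_nonneg v.+1 p' else (0 < v)%N && stays_nonneg v.-1 p'
  else true.

Lemma chains_cat_nseq p n ds : chains (p ++ nseq n false) ds = chains p ds.
Proof.
elim: p ds => [|[] p IH] ds /=; last exact: IH.
  by elim: n ds => //=.
by apply: eq_bigr => k _; rewrite IH.
Qed.

(** Induction along p: [ev_up] expands B_d at a U step, and a D step sends it to a single basis
    element. The product never changes, since [last d ds] is d_0 and grows by one exactly when a D
    step is consumed. *)
Lemma mev_wmult p d ds : stays_nonneg (size ds) p -> path leq d ds ->
  mev (blocks 0 (d :: ds)) (wmult p) =
  chains p (d :: ds) * \prod_(e <- iota 0 (last d ds + count negb p)) (1 + q ^+ e * t).
Proof.
elim: p d ds => [|b p IH] d ds; first by move=> _ pds; rewrite mev_exp //= subn0 addn0 mul1r.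
case: b => [|] okp pds.
  rewrite [chains _ _]/= big_distrl /= subn0.
  pose f b a := mev (blocks d ds) (fun s => wmult p [:: b, a & s]).
  transitivity (ev (iota 0 d) (fun m => \sum_(i < m.+1) q ^+ i * f i (m - i)%N +
                          \sum_(i < m) q ^+ i.+1 * f i (m - i.+1)%N)).
    by apply: eq_ev => m; rewrite mevD !mev_sum; congr (_ + _);
      apply: eq_bigr => i _; rewrite mevZ.
  rewrite ev_up; apply: eq_bigr => k _.
  rewrite -mulrA -(IH k (d :: ds)) //=; last by rewrite pds andbT -ltnS.
  by rewrite !subn0.
case: ds okp pds => [//|d2 ds] /= okp /andP[led pds].
pose G m := mev (blocks d2 ds) (fun s => q ^+ sumn s * (wmult p (m :: s) + wmult p (m.+1 :: s))).
(* Only the sum of the first two multiplicities matters after a D step, so [iota 0 d] and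
   [iota d (d2 - d)] join into [iota 0 d2]. *)
transitivity (ev (iota 0 d2) (fun m => q ^+ m * G m)).
  rewrite -[in RHS](subnKC led) iotaD ev_cat add0n subn0; apply: eq_ev => a; apply: eq_ev => b.
  rewrite -mevZ; apply: eq_mev => s; rewrite !exprD; ring.
rewrite addnS -addSn.
have -> : (last d2 ds).+1 = last d2.+1 (map S ds) by rewrite (last_map S).
rewrite -IH ?size_map //; last by rewrite path_map.
(* The factor q^m moves the block to the exponents 1, ..., d2; the choice of one extra new tile
   supplies the missing factor 1 + x, of exponent 0. *)
rewrite -ev_shift /= (_ : iota 1 d2 = map S (iota 0 d2)); last by rewrite -(iotaDl 1).
apply: eq_ev => m; rewrite /G mul1r -mevD -map_blocks mev_shift.
by apply: eq_mev.
Qed.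

End ShiftOperators.

(** * Runs of states *)

Section Runs.
Variable H : nat -> nat.

Definition top_count x (c : seq nat) := count (fun l => H l == H x) c.

(* A state c in column x lists, by increasing level, the left ends of the tiles
   met there; in the next column the i topmost ones are dropped and e new tiles
   start. *)
Definition next x (c : seq nat) i e := take (size c - i) c ++ nseq e x.+1.

(** The size of a state is half the gap between the two paths, so it stays or falls by one at a U
    step and stays or grows by one at a D step. A D step goes below every left end of height [H x],
    hence stops all these tiles. *)
Definition succs (b : bool) x c : seq (seq nat) :=
  let m := top_count x c in
  if b then [seq next x c i i | i <- iota 0 m.+1] ++ [seq next x c i.+1 i | i <- iota 0 m]
  else [:: next x c m m; next x c m m.+1].

Fixpoint runs (p : seq bool) x c : seq (seq (seq nat)) :=
  if p is b :: p' then [seq c' :: r | c' <- succs b x c, r <- runs p' x.+1 c']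
  else [:: [::]].

(** Sortedness of the heights makes the tiles that may stop, those with left end at height [H x], a
    suffix of the state. *)
Definition state_inv x c :=
  [/\ sorted leq c, all (leq^~ x) c, sorted leq (map H c) & all (fun l => H l <= H x) c].

Definition Hstep (b : bool) x := if b then H x.+1 = (H x).+1 else H x = (H x.+1).+1.

Definition follows (p : seq bool) x := forall i, i < size p -> Hstep (nth false p i) (x + i).

Lemma follows_cons b p x : follows (b :: p) x -> Hstep b x /\ follows p x.+1.
Proof.
move=> fp; split; first by have := fp 0 isT; rewrite addn0.
by move=> i ip; have := fp i.+1 ip; rewrite addnS addSn.
Qed.

Lemma sorted_count_max v (s : seq nat) : sorted leq s -> all (leq^~ v) s ->
  let j := size s - count (pred1 v) s in
  all (ltn^~ v) (take j s) /\ all (pred1 v) (drop j s).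
Proof.
elim: s => [|a s IH] //= ps /andP[av allv].
have [E|ne] := eqVneq a v.
  have E2 : all (pred1 v) s.
    rewrite E in ps; apply/allP => y ys /=.
    rewrite eqn_leq (allP allv) //=.
    by have /allP := order_path_min leq_trans ps; apply.
  move: (E2); rewrite all_count => /eqP ->.
  by rewrite add1n subnn /= E eqxx.
have := IH (path_sorted ps) allv; rewrite add0n subSn ?count_size //= => -[-> ->].
by rewrite andbT ltn_neqAle ne.
Qed.

Lemma state_split x c : state_inv x c ->
  let j := size c - top_count x c in
  all (fun l => H l < H x) (take j c) /\ all (fun l => H l == H x) (drop j c).
Proof.
case=> _ _ sH aH.
have := @sorted_count_max (H x) (map H c) sH.
rewrite all_map => /(_ aH) /=; rewrite size_map count_map -map_take -map_drop !all_map.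
by [].
Qed.

Lemma state_drop_top x c i : state_inv x c -> i <= top_count x c ->
  all (fun l => H l == H x) (drop (size c - i) c).
Proof.
move=> /state_split[_ a2] le.
have -> : size c - i = (top_count x c - i) + (size c - top_count x c).
  have : top_count x c <= size c by apply: count_size.
  lia.
rewrite -drop_drop; apply/allP => l /mem_drop; exact: (allP a2).
Qed.

Lemma size_next x c i e : i <= size c -> size (next x c i e) = size c - i + e.
Proof. by move=> le; rewrite size_cat size_nseq size_takel ?leq_subr. Qed.

Lemma count_next_fresh x c i e : all (leq^~ x) c -> count (pred1 x.+1) (next x c i e) = e.
Proof.
move=> ax; rewrite count_cat count_nseq /= eqxx mul1n.
rewrite (eq_in_count (a2 := pred0)) ?count_pred0 // => l /mem_take /(allP ax) /=; lia.
Qed.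

Lemma count_next_old x c i e : i <= size c -> all (leq^~ x) c ->
  count (leq^~ x) (next x c i e) = size c - i.
Proof.
move=> le ax; rewrite count_cat count_nseq /= ltnn mul0n addn0.
rewrite (eq_in_count (a2 := predT)) ?count_predT ?size_takel ?leq_subr //.
by move=> l /mem_take /(allP ax).
Qed.

Lemma top_count_size x c : top_count x c <= size c.
Proof. exact: count_size. Qed.

(** The number of entries [x.+1] recovers the number of new tiles, and the two families at a U step
    differ in size. *)
Lemma succs_uniq b x c : all (leq^~ x) c -> uniq (succs b x c).
Proof.
move=> ax; have cm := top_count_size x c; case: b; rewrite /succs.
  rewrite cat_uniq !map_inj_in_uniq ?iota_uniq ?andbT.
  - apply/hasPn => s /mapP[i]; rewrite mem_iota => /andP[_ im] ->.
    apply/mapP => -[i']; rewrite mem_iota => /andP[_ im'] /(congr1 size).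
    by rewrite !size_next; lia.
  - by move=> i i' _ _ /(congr1 (count (pred1 x.+1))); rewrite !count_next_fresh.
  - by move=> i i' _ _ /(congr1 (count (pred1 x.+1))); rewrite !count_next_fresh.
rewrite /= inE andbT; apply/eqP => /(congr1 (count (pred1 x.+1))).
by rewrite !count_next_fresh; lia.
Qed.

(** A description by the number j of continuing tiles, which is what can be read off a tiling. *)
Inductive succs_spec b x c c' : Prop :=
  SuccsSpec j e of j <= size c & c' = take j c ++ nseq e x.+1
    & all (fun l => H l == H x) (drop j c)
    & (b || all (fun l => H l < H x) (take j c))
    & (if b then j + e = size c \/ (j + e).+1 = size c
       else j + e = size c \/ j + e = (size c).+1).

Lemma mem_succs b x c c' : state_inv x c -> c' \in succs b x c -> succs_spec b x c c'.
Proof.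
move=> inv; have cm := top_count_size x c; case: b; rewrite /succs.
  rewrite mem_cat.
  case/orP => /mapP[i]; rewrite mem_iota => /andP[_ im] ->.
    exists (size c - i) i; rewrite ?leq_subr ?state_drop_top //; lia.
  exists (size c - i.+1) i; rewrite ?leq_subr ?state_drop_top //; lia.
have [a1 a2] := state_split inv.
rewrite !inE => /orP[] /eqP ->.
  exists (size c - top_count x c) (top_count x c); rewrite ?leq_subr //; lia.
exists (size c - top_count x c) (top_count x c).+1; rewrite ?leq_subr //; lia.
Qed.

Lemma succs_intro b x c c' : succs_spec b x c c' -> c' \in succs b x c.
Proof.
case=> j e le -> a2 a1 se.
have cj : size c - j <= top_count x c.
  rewrite /top_count -{2}(cat_take_drop j c) count_cat.
  move: a2; rewrite all_count => /eqP ->; rewrite size_drop; lia.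
have jE : j = size c - (size c - j) by lia.
case: b a1 se; rewrite /succs.
  move=> _ se; rewrite mem_cat; apply/orP.
  case: se => se; [left|right]; apply/mapP; exists e; rewrite ?mem_iota /next; try lia.
    by congr (take _ _ ++ _); lia.
  by congr (take _ _ ++ _); lia.
move=> /= a1 se.
have ce : top_count x c = size c - j.
  rewrite /top_count -{1}(cat_take_drop j c) count_cat.
  move: a2; rewrite all_count => /eqP ->; rewrite size_drop.
  rewrite (eq_in_count (a2 := pred0)) ?count_pred0 // => l /(allP a1) /=; lia.
by rewrite !inE /next ce -jE; case: se => se; apply/orP; [left|right];
  apply/eqP; congr (_ ++ nseq _ _); lia.
Qed.

Lemma state_inv_succs b x c c' : Hstep b x -> state_inv x c ->
  c' \in succs b x c -> state_inv x.+1 c'.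
Proof.
move=> hs inv /(mem_succs inv)[j e le -> a2 a1 _]; case: inv => s1 al s2 aH.
(* At a U step the bound [H x] only grows; at a D step the kept left ends are strictly lower than
   [H x]. *)
have aH' : all (fun l => H l <= H x.+1) (take j c).
  apply/allP => l lin; case: b hs a1 => /= hs.
    by move=> _; have := allP aH _ (mem_take lin); lia.
  by move=> /allP/(_ _ lin); lia.
have hn e' : all (fun l => H l <= H x.+1) (nseq e' x.+1) by rewrite all_nseq /= leqnn orbT.
split.
- rewrite sorted_pairwise; last exact: leq_trans.
  rewrite pairwise_cat -!sorted_pairwise ?take_sorted //; try exact: leq_trans.
  rewrite /= andbC; apply/andP; split.
    by elim: e => //= e IH; case: e IH => //= e ->; rewrite leqnn.
  apply/allrelP => a b' /mem_take /(allP al) /= ax /nseqP[-> _]; lia.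
- rewrite all_cat all_nseq leqnn orbT andbT; apply/allP => l /mem_take /(allP al) /=; lia.
- rewrite map_cat map_take sorted_pairwise; last exact: leq_trans.
  rewrite pairwise_cat -!sorted_pairwise ?take_sorted //; try exact: leq_trans.
  rewrite /= andbC; apply/andP; split.
    by elim: e => //= e IH; case: e IH => //= e ->; rewrite leqnn.
  rewrite -map_take; apply/allrelP => a b' /mapP[l lin ->] /mapP[l' /nseqP[-> _] ->].
  exact: (allP aH').
by rewrite all_cat aH' hn.
Qed.

Lemma runs_uniq p x c : follows p x -> state_inv x c -> uniq (runs p x c).
Proof.
elim: p x c => [|b p IH] x c //= /follows_cons[hs fp] inv.
apply: allpairs_uniq_dep => [|c' c'in|].
- by apply: succs_uniq; case: inv.
- by apply: IH => //; apply: state_inv_succs c'in.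
by move=> [c1 r1] [c2 r2] _ _ /= [-> ->].
Qed.

Lemma mem_runs p x c r : reflect
  (size r = size p /\ forall i, i < size p ->
     nth [::] (c :: r) i.+1 \in succs (nth false p i) (x + i) (nth [::] (c :: r) i))
  (r \in runs p x c).
Proof.
elim: p x c r => [|b p IH] x c r /=.
  by rewrite inE; apply: (iffP eqP) => [->|[/size0nil]].
apply: (iffP allpairsPdep) => [[c' [r' [c'in /IH[sr' H'] ->]]]|[]].
  split=> /=; first by rewrite sr'.
  case=> [|i] /= ip; first by rewrite addn0.
  by rewrite addnS -addSn; apply: H'.
case: r => // c' r [sr] hr; exists c', r; split=> //.
  by have := hr 0 isT; rewrite addn0.
by apply/IH; split=> // i ip; have := hr i.+1 ip; rewrite addnS -addSn.
Qed.

Local Open Scope ring_scope.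

(** * Weights of runs and their sum *)

Section Weights.
Variables (R : comPzRingType) (q t : R).

(* [count (leq^~ x) c'] is the number of tiles that continue into column x + 1. *)
Definition step_art (b : bool) x (c c' : seq nat) : nat :=
  if b then (size c - count (leq^~ x) c')%N else size c.

Fixpoint run_weight (p : seq bool) x c (r : seq (seq nat)) : R :=
  match p, r with
  | b :: p', c' :: r' => q ^+ step_art b x c c' * run_weight p' x.+1 c' r'
  | _, _ => t ^+ size c
  end.

Lemma run_weightE p x c r : size r = size p ->
  run_weight p x c r =
  q ^+ (\sum_(i < size p) step_art (nth false p i) (x + i)
          (nth [::] (c :: r) i) (nth [::] (c :: r) i.+1))
  * t ^+ size (nth [::] (c :: r) (size p)).
Proof.
elim: p x c r => [|b p IH] x c [|c' r] //=; first by rewrite big_ord0 mul1r.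
case=> sr; rewrite big_ord_recl /= addn0 exprD -mulrA IH //; congr (_ * (_ ^+ _ * _)).
by apply: eq_bigr => i _; rewrite /bump /= addnS.
Qed.

Fixpoint mult v (c : seq nat) : seq nat :=
  count (fun l => H l == v) c :: if v is v'.+1 then mult v' c else [::].

Lemma eq_mult v c c' :
  (forall u, (u <= v)%N -> count (fun l => H l == u) c = count (fun l => H l == u) c') ->
  mult v c = mult v c'.
Proof.
elim: v => [|v IH] e /=; rewrite ?e //; congr (_ :: _).
by apply: IH => u uv; apply: e; apply: leqW.
Qed.

Lemma sumn_mult v c : all (fun l => H l <= v)%N c -> sumn (mult v c) = size c.
Proof.
move=> av; transitivity (count (fun l => H l <= v)%N c); last by move: av; rewrite all_count => /eqP.
elim: v {av} => [|v IH] /=.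
  by rewrite addn0; apply: eq_count => l; rewrite leqn0.
by rewrite IH; elim: c {IH} => //= l c IHc; rewrite -IHc; lia.
Qed.

Lemma multE v c : mult v c = count (fun l => H l == v) c :: behead (mult v c).
Proof. by case: v. Qed.

Lemma count_next_lt x c i e u : state_inv x c -> (i <= top_count x c)%N ->
  u != H x -> count (fun l => H l == u) (next x c i e) =
    (count (fun l => H l == u) c + (H x.+1 == u) * e)%N.
Proof.
move=> inv le ne; rewrite count_cat count_nseq; congr (_ + _)%N.
rewrite -[in RHS](cat_take_drop (size c - i) c) count_cat [X in (_ + X)%N](eq_in_count (a2 := pred0)).
  by rewrite count_pred0 addn0.
by move=> l /(allP (state_drop_top inv le)) /eqP -> /=; rewrite eq_sym (negbTE ne).
Qed.

Lemma count_next_top x c i e : state_inv x c -> (i <= top_count x c)%N ->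
  H x.+1 != H x -> count (fun l => H l == H x) (next x c i e) = (top_count x c - i)%N.
Proof.
move=> inv le ne; rewrite count_cat count_nseq (negbTE ne) mul0n addn0.
rewrite /top_count -[in RHS](cat_take_drop (size c - i) c) count_cat.
move: (state_drop_top inv le); rewrite all_count => /eqP ->; rewrite size_drop.
have := top_count_size x c; lia.
Qed.

Lemma big_iota0 n (F : nat -> R) : \sum_(i <- iota 0 n) F i = \sum_(i < n) F i.
Proof. by rewrite -(big_mkord xpredT F) /index_iota subn0. Qed.

(** Step weights and the multiplicities after a step depend on the state only through its
    multiplicities, so summing over successors reproduces the recursion of [wmult]. *)
Lemma sum_runs p x c : follows p x -> state_inv x c ->
  stays_nonneg (H x) p ->
  \sum_(r <- runs p x c) run_weight p x c r = wmult q t p (mult (H x) c).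
Proof.
elim: p x c => [|b p IH] x c.
  by move=> _ [_ _ _ aH] _; rewrite big_seq1 /= sumn_mult.
move=> /follows_cons[hs fp] inv ok; have cm := top_count_size x c.
have ax : all (leq^~ x) c by case: inv.
have IH' c' : c' \in succs b x c -> stays_nonneg (H x.+1) p ->
    \sum_(r <- runs p x.+1 c') run_weight p x.+1 c' r = wmult q t p (mult (H x.+1) c').
  by move=> c'in; apply: IH => //; apply: state_inv_succs c'in.
transitivity (\sum_(c' <- succs b x c)
    q ^+ step_art b x c c' * wmult q t p (mult (H x.+1) c')).
  rewrite [LHS]big_allpairs_dep /= big_seq [RHS]big_seq; apply: eq_bigr => c' c'in.
  rewrite -IH' // ?big_distrr //; by case: (b) hs ok => /= -> //.
have multU i e : b -> (i <= top_count x c)%N ->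
    mult (H x.+1) (next x c i e) = [:: e, (top_count x c - i)%N & behead (mult (H x) c)].
  move=> bb le; rewrite bb /= in hs; rewrite hs /= count_next_lt //; last by lia.
  rewrite hs eqxx mul1n (_ : count _ c = 0%N); last first.
    rewrite (eq_in_count (a2 := pred0)) ?count_pred0 // => l lc /=.
    by case: inv => _ _ _ /allP/(_ _ lc); lia.
  congr (_ :: _); rewrite multE count_next_top //; last by lia.
  (* Below height [H x] nothing changes: dropped tiles have height [H x], new ones [(H x).+1]. *)
  congr (_ :: _); case Hv: (H x) => [//|v]; apply: eq_mult => u uv.
  rewrite count_next_lt //; last by lia.
  by rewrite (_ : (_ == u) = false) ?mul0n ?addn0 //; lia.
case: b hs IH' ok multU => hs IH' ok multU; rewrite /succs.
  rewrite big_cat !big_map [wmult _ _ _ _]/= [mult _ _]multE [head _ _]/= -/(top_count x c) [behead _]/=.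
  by rewrite !big_iota0; congr (_ + _); apply: eq_bigr => i _; have im := ltn_ord i;
    rewrite multU /step_art ?count_next_old ?subKn //; lia.
(* New tiles start one unit lower and join those already counted at that height. *)
have multD e : mult (H x.+1) (next x c (top_count x c) e) =
    (head 0%N (behead (mult (H x) c)) + e)%N :: behead (behead (mult (H x) c)).
  rewrite /Hstep in hs; rewrite hs /= [mult (H x.+1) c]multE [LHS]multE /= count_next_lt //; last by lia.
  rewrite eqxx mul1n; congr (_ :: _).
  case Hv: (H x.+1) => [//|v]; apply: eq_mult => u uv.
  rewrite count_next_lt //; last by lia.
  by rewrite (_ : (_ == u) = false) ?mul0n ?addn0 //; lia.
rewrite !big_cons big_nil addr0 -mulrDr [RHS]/= sumn_mult; last by case: inv.
rewrite !multD !addnS [(head _ _ + _)%N]addnC; congr (_ * (wmult _ _ _ (_ :: _) + wmult _ _ _ (_ :: _)));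
  by rewrite multE.
Qed.

End Weights.
End Runs.

(** * Tiles as graphs of functions *)

Section Tiles.
Variable N : nat.
Implicit Type T : {set box N}.

Definition graph_tile (f : nat -> nat) l r T : Prop :=
  [/\ l <= r, r <= N, forall x, l <= x <= r -> f x <= N
    & T = [set z : box N | (l <= z.1 <= r) && (z.2 == f z.1 :> nat)]].

Lemma ctr_inj : injective (@ctr N).
Proof. by move=> [a b] [a' b'] [] /val_inj -> /val_inj ->. Qed.

Lemma size_centers T : size (centers T) = #|T|.
Proof. by rewrite size_sort size_map -cardE. Qed.

Lemma mem_centers T (z : box N) : (ctr z \in centers T) = (z \in T).
Proof. by rewrite mem_sort mem_map ?mem_enum //; apply: ctr_inj. Qed.

(** Comparison of columns is antisymmetric on a graph, though not on all boxes, so the sorted list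
    of its centers is unique. *)
Lemma centers_graph f l r T : graph_tile f l r T ->
  centers T = [seq (x, f x) | x <- iota l (r - l).+1].
Proof.
case=> lr rN fN ->.
set s2 := map _ _; set D := [set z | _].
have uc : uniq (centers D) by rewrite sort_uniq map_inj_uniq ?enum_uniq //; apply: ctr_inj.
have u2 : uniq s2 by rewrite map_inj_uniq ?iota_uniq // => x y [].
have memD c : (c \in centers D) = (c \in s2).
  apply/idP/mapP => [|[x]].
    rewrite mem_sort => /mapP[z]; rewrite mem_enum inE => /andP[h /eqP e] ->.
    by exists (z.1 : nat); [rewrite mem_iota addnS subnKC // ltnS | rewrite /ctr e].
  rewrite mem_iota => hx ->; have hx' : l <= x <= r by lia.
  have xN : x < N.+1 by lia.
  have fxN : f x < N.+1 by have := fN x hx'; lia.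
  rewrite -[(x, f x)]/(ctr ((Ordinal xN, Ordinal fxN) : box N)) mem_centers inE /= eqxx andbT; lia.
apply: (@sorted_eq_in _ (fun c d : nat * nat => c.1 <= d.1)).
- by move=> a b c _ _ _ /=; apply: leq_trans.
- move=> a b; rewrite !memD => /mapP[x _ ->] /mapP[y _ ->] /=.
  by rewrite -eqn_leq => /eqP ->.
- by apply: sort_sorted => a b; apply: leq_total.
- rewrite sorted_map; apply: sub_sorted (iota_sorted l _) => x y /=; lia.
by apply: uniq_perm.
Qed.

Lemma centers_graphE f l r T : graph_tile f l r T ->
  centers T = (l, f l) :: [seq (x, f x) | x <- iota l.+1 (r - l)].
Proof. by move/centers_graph ->. Qed.

Lemma last_graph (f : nat -> nat) l n : last (l, f l) [seq (x, f x) | x <- iota l.+1 n] = (l + n, f (l + n)).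
Proof.
by rewrite (last_map (fun x => (x, f x))) (last_nth 0) -/(iota l n.+1) size_iota nth_iota ?addn0.
Qed.

Lemma tile_rise_graph f l r T : graph_tile f l r T -> tile_rise T = f r - f l.
Proof.
move=> g; rewrite /tile_rise (centers_graphE g) last_graph /= subnKC //; by case: g.
Qed.

Lemma anchored_graph f l r T : graph_tile f l r T -> anchored T = (r == N).
Proof.
by move=> g; rewrite /anchored /rightmost (centers_graphE g) /= last_graph /= subnKC //; case: g.
Qed.

Lemma card_graph f l r T : graph_tile f l r T -> #|T| = (r - l).+1.
Proof. by move=> g; rewrite -size_centers (centers_graph g) size_map size_iota. Qed.

Lemma ballot_tile_graph f l r T : graph_tile f l r T ->
  ballot_tile T <->
  (forall x, l <= x < r -> f x.+1 = f x + 1 \/ f x.+1 + 1 = f x) /\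
  (forall x, l <= x <= r -> f l <= f x).
Proof.
move=> g; rewrite /ballot_tile (centers_graphE g); case: g => lr _ _ _.
split=> [/andP[/(pathP (0,0)) hp /allP ha]|[hs hm]].
  split=> x hx.
    have i : x - l < r - l by lia.
    have := hp (x - l); rewrite size_map size_iota => /(_ i).
    rewrite -[(l, f l) :: _]/[seq (x, f x) | x <- iota l (r - l).+1].
    rewrite !(nth_map 0) ?size_iota ?nth_iota //; try lia.
    rewrite /tstep /= (_ : l + (x - l) = x); last by lia.
    rewrite (_ : l.+1 + (x - l) = x.+1); last by lia.
    by case/andP => _ /orP[] /eqP; [left|right].
  have [->//|ne] := eqVneq x l.
  by apply: (ha (x, f x)); apply/mapP; exists x; rewrite ?mem_iota //; lia.
apply/andP; split.
  apply/(pathP (0,0)) => i; rewrite size_map size_iota => ir.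
  rewrite -[(l, f l) :: _]/[seq (x, f x) | x <- iota l (r - l).+1].
  rewrite !(nth_map 0) ?size_iota ?nth_iota //; try lia.
  rewrite /tstep /=; apply/andP; split; first by apply/eqP; lia.
  have := hs (l + i); rewrite addSn => h; apply/orP.
  by case: h => [|->|->]; [lia|left|right].
apply/allP => c /mapP[x]; rewrite mem_iota => hx -> /=; apply: hm; lia.
Qed.

(** Each step moves one column to the right, so the i-th center lies in column [c0.1 + i] and its
    height is a function of the column. *)
Lemma ballot_tile_is_graph T : ballot_tile T -> exists f l r, graph_tile f l r T.
Proof.
rewrite /ballot_tile; case cE: (centers T) => [//|c0 s] /andP[/(pathP (0,0)) hp _].
have colE i : i <= size s -> (nth (0,0) (c0 :: s) i).1 = c0.1 + i.
  elim: i => [|i IH] le; first by rewrite addn0.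
  by have /andP[/eqP /= -> _] := hp i le; rewrite IH; lia.
pose f x := (nth (0,0) (c0 :: s) (x - c0.1)).2.
have memN c : c \in c0 :: s -> exists2 z : box N, z \in T & c = ctr z.
  by rewrite -cE mem_sort => /mapP[z]; rewrite mem_enum; exists z.
have nthE i : i <= size s -> nth (0,0) (c0 :: s) i = (c0.1 + i, f (c0.1 + i)).
  move=> le; rewrite /f addKn -(colE i le); by case: (nth _ _ _).
exists f, c0.1, (c0.1 + size s); split.
- exact: leq_addr.
- have [z _ zE] := memN _ (mem_nth (0,0) (ltnSn (size s) : size s < size (c0 :: s))).
  by rewrite -colE // zE -ltnS ltn_ord.
- move=> x hx; have le : x - c0.1 < size (c0 :: s) by rewrite /=; lia.
  have [z _ zE] := memN _ (mem_nth (0,0) le).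
  by rewrite /f zE -ltnS ltn_ord.
apply/setP => -[a b]; rewrite -mem_centers cE [RHS]inE /ctr /=; apply/idP/andP => [|[hz /eqP e]].
  move/(nthP (0,0)) => [i ile /=]; rewrite nthE // => -[<- <-].
  by rewrite eqxx leq_addr leq_add2l -ltnS ile.
have le : a - c0.1 < size (c0 :: s) by rewrite /=; lia.
have := mem_nth (0,0) le; rewrite nthE //.
by rewrite subnKC ?e //; case/andP: hz.
Qed.

Definition start T := (head (0, 0) (centers T)).1.

Lemma start_graph f l r T : graph_tile f l r T -> start T = l.
Proof. by move=> g; rewrite /start (centers_graphE g). Qed.

End Tiles.

(** * Heights and skew shapes *)

Section Heights.

(** The subtraction truncates, so this agrees with [height] only where the latter is nonnegative, as
    on ballot paths. *)
Definition ht (p : seq bool) x : nat := count id (take x p) - count negb (take x p).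

Lemma height0 p : height p 0 = 0%R. Proof. by rewrite /height take0. Qed.

Lemma height_cons b p x :
  height (b :: p) x.+1 = ((if b then 1 else -1) + height p x)%R.
Proof. rewrite /height /=; case: b => /=; lia. Qed.

Lemma heightS p x : x < size p ->
  height p x.+1 = (height p x + if nth false p x then 1 else -1)%R.
Proof.
move=> xp; rewrite /height (take_nth false) // -cats1 !count_cat /=.
case: (nth false p x) => /=; lia.
Qed.

Lemma ballot_height p x : ballot p -> x <= size p -> height p x = Posz (ht p x).
Proof. move=> /forallP /[swap] xp /(_ (inord x)); rewrite inordK // /height /ht; lia. Qed.

Lemma above_height p p' x : above p p' -> x <= size p -> (height p x <= height p' x)%R.
Proof. by move=> /forallP /[swap] xp /(_ (inord x)); rewrite inordK. Qed.

Lemma above_ballot lam mu : size mu = size lam -> ballot lam -> above lam mu -> ballot mu.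
Proof.
move=> smu bl ab; apply/forallP => x; have xl : x <= size lam by rewrite -smu -ltnS.
by have := above_height ab xl; rewrite (ballot_height bl xl); lia.
Qed.

Lemma ht0 p : ht p 0 = 0. Proof. by rewrite /ht take0. Qed.

Lemma ht_step p x : ballot p -> x < size p -> Hstep (ht p) (nth false p x) x.
Proof.
move=> bp xp; have := heightS xp; rewrite !ballot_height // ?(ltnW xp) // /Hstep.
case: (nth _ _ _); lia.
Qed.

Lemma ht_le p x : ht p x <= x.
Proof.
apply: leq_trans (leq_subr _ _) _; apply: leq_trans (count_size _ _) _.
by rewrite size_take; case: ltnP.
Qed.

Lemma odd_ht p x : ballot p -> x <= size p -> odd (ht p x) = odd x.
Proof.
move=> bp; elim: x => [|x IH] xp; first by rewrite ht0.
have := ht_step bp xp; rewrite /Hstep; have := IH (ltnW xp).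
by case: (nth _ _ _) => /=; lia.
Qed.

Lemma stays_nonnegP v p : (forall x, x <= size p -> (0 <= Posz v + height p x)%R) ->
  stays_nonneg v p.
Proof.
elim: p v => [|b p IH] v hp //=.
have hp' x : x <= size p -> (0 <= (Posz v + if b then 1 else -1) + height p x)%R.
  by move=> xp; have := hp x.+1 xp; rewrite height_cons; lia.
case: b hp' {hp} => hp'; first by apply: IH => x /hp'; lia.
have v0 : 0 < v by have := hp' 0 isT; rewrite height0; lia.
by rewrite v0; apply: IH => x /hp'; lia.
Qed.

Lemma ballot_stays_nonneg p : ballot p -> stays_nonneg 0 p.
Proof. by move=> bp; apply: stays_nonnegP => x xp; rewrite ballot_height //; lia. Qed.

Lemma height_inj p p' : size p = size p' ->
  (forall x, x <= size p -> height p x = height p' x) -> p = p'.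
Proof.
move=> sp hp; apply: (eq_from_nth (x0 := false) sp) => i ip.
have := hp _ ip; rewrite !heightS -?sp // hp ?(ltnW ip) //.
by case: (nth _ p i); case: (nth _ p' i); lia.
Qed.

Definition half_gap lam mu x := (ht mu x - ht lam x)./2.

Definition level N (H : nat -> nat) (z : box N) := (z.2 - H z.1).-1./2.

Definition line (H : nat -> nat) k x := H x + k.*2.+1.

(** Since [level] rounds down, the equation with [line] encodes both the parity of a center and its
    position above H. *)
Definition layered N (H h : nat -> nat) (D : {set box N}) :=
  D = [set z : box N | (z.2 == line H (level H z) z.1 :> nat) && (level H z < h z.1)].

Section Skew.
Variables lam mu : seq bool.
Hypotheses (smu : size mu = size lam) (bl : ballot lam) (ab : above lam mu).

Lemma half_gapE x : x <= size lam -> ht mu x = ht lam x + (half_gap lam mu x).*2.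
Proof.
move=> xl; have bm := above_ballot smu bl ab.
have := above_height ab xl; rewrite !ballot_height ?smu // => le.
have := odd_ht bl xl; have := @odd_ht mu x bm; rewrite smu /half_gap => /(_ xl); lia.
Qed.

Lemma half_gap_step x : x < size lam ->
  if nth false lam x then half_gap lam mu x.+1 = half_gap lam mu x \/
                          (half_gap lam mu x.+1).+1 = half_gap lam mu x
  else half_gap lam mu x.+1 = half_gap lam mu x \/
       half_gap lam mu x.+1 = (half_gap lam mu x).+1.
Proof.
move=> xl; have bm := above_ballot smu bl ab.
have := half_gapE xl; have := half_gapE (ltnW xl).
have := ht_step bl xl; have := @ht_step mu x bm; rewrite smu /Hstep => /(_ xl).
case: (nth _ _ _); case: (nth _ _ _); lia.
Qed.

(** The bound [c.2 + 1 <= c.1] holds automatically below mu, because a path has height at most x in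
    column x. *)
Lemma skewS_layered : layered (ht lam) (half_gap lam mu) (skewS lam mu).
Proof.
have bm := above_ballot smu bl ab.
apply/setP => -[a b]; rewrite !inE /inS /ctr /level /line /= smu.
have al : a <= size lam by rewrite -ltnS ltn_ord.
rewrite !ballot_height ?smu //.
have := half_gapE al; have := odd_ht bl al; have := ht_le mu a.
move: (ht lam a) (ht mu a) (half_gap lam mu a) => x y k le od E.
move: (nat_of_ord a) (nat_of_ord b) al le od => {}a {}b al le od.
rewrite al oddD -od andbT.
rewrite (_ : (Posz x + 1 <= Posz b)%R = (x < b)); last by lia.
rewrite (_ : (Posz y + 1 <= Posz b)%R = (y < b)); last by lia.
lia.
Qed.

End Skew.
End Heights.

(** * The correspondence between tilings and runs *)

Section LayeredTilings.
Variables (N : nat) (b : nat -> bool) (H h : nat -> nat) (D : {set box N}).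
Hypothesis Hstep_b : forall x, x < N -> Hstep H (b x) x.
Hypothesis gap_le : forall x, x <= N -> H x + (h x).*2 <= x.
Hypothesis gap_step : forall x, x < N ->
  if b x then h x.+1 = h x \/ (h x.+1).+1 = h x else h x.+1 = h x \/ h x.+1 = (h x).+1.
Hypothesis D_layered : layered H h D.

(** Total thanks to [inord], but the intended box only when x <= N and k < h x. *)
Definition cell x k : box N := (inord x, inord (line H k x)).

Arguments cell : simpl never.

Lemma line_le x k : x <= N -> k < h x -> line H k x <= N.
Proof. by move=> xN; have := gap_le xN; rewrite /line; lia. Qed.

Lemma cell1 x k : x <= N -> (cell x k).1 = x :> nat.
Proof. by move=> xN; rewrite inordK. Qed.

Lemma cell2 x k : x <= N -> k < h x -> (cell x k).2 = line H k x :> nat.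
Proof. by move=> xN kh; rewrite inordK // ltnS line_le. Qed.

Lemma level_line (z : box N) k : z.2 = line H k z.1 :> nat -> level H z = k.
Proof. by rewrite /level /line; lia. Qed.

Lemma level_cell x k : x <= N -> k < h x -> level H (cell x k) = k.
Proof. by move=> xN kh; apply: level_line; rewrite cell2 // cell1. Qed.

Lemma mem_D z : (z \in D) = (z.2 == line H (level H z) z.1 :> nat) && (level H z < h z.1).
Proof. by rewrite D_layered inE. Qed.

Lemma cell_in x k : x <= N -> k < h x -> cell x k \in D.
Proof. by move=> xN kh; rewrite mem_D level_cell // cell2 // cell1 // eqxx. Qed.

Lemma cell_level z : z \in D -> z = cell z.1 (level H z).
Proof.
rewrite mem_D => /andP[/eqP e lh]; have zN : z.1 <= N by rewrite -ltnS ltn_ord.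
by apply: ctr_inj; rewrite /ctr cell1 // cell2 // -e.
Qed.

Lemma sum_layered (g : box N -> nat) :
  \sum_(z in D) g z = \sum_(x < N.+1) \sum_(k < h x) g (cell x k).
Proof.
transitivity (\sum_(z <- [seq cell x k | x <- iota 0 N.+1, k <- iota 0 (h x)]) g z).
  rewrite -big_filter; apply: perm_big; apply: uniq_perm.
  - by rewrite filter_uniq // index_enum_uniq.
  - apply: allpairs_uniq_dep => [|x _|]; rewrite ?iota_uniq //.
    move=> [x1 k1] [x2 k2] /allpairsPdep[x [k [xi ki [-> ->]]]].
    move=> /allpairsPdep[x' [k' [xi' ki' [-> ->]]]] /= e.
    move: xi ki xi' ki'; rewrite !mem_iota /= => xi ki xi' ki'.
    have ex : x = x' by rewrite -(@cell1 x k) 1?e ?cell1 //.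
    rewrite -ex in ki' e *; have := congr1 (@level N H) e.
    by rewrite !level_cell // => ->.
  move=> z; rewrite mem_filter mem_index_enum andbT; apply/idP/allpairsPdep.
    move=> zD; exists (z.1 : nat), (level H z); rewrite !mem_iota /= ltn_ord.
    by rewrite -cell_level //; move: zD; rewrite mem_D => /andP[].
  by move=> [x [k [xi ki ->]]]; move: xi ki; rewrite !mem_iota /= => xi ki; apply: cell_in.
rewrite big_allpairs_dep /= -(big_mkord xpredT (fun x => \sum_(k < h x) g (cell x k))).
rewrite /index_iota subn0; apply: eq_bigr => x _.
by rewrite -(big_mkord xpredT (fun k => g (cell x k))) /index_iota subn0.
Qed.

(** For a tile of length (2n, n') over the columns l to r this identifies n with the number of D
    steps between them. *)
Lemma height_gain l r : l <= r -> r <= N ->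
  H r + (\sum_(l <= x < r) ~~ b x).*2 = H l + (r - l).
Proof using Hstep_b.
move=> lr; rewrite -(subnKC lr); elim: (r - l) => [|n IH] rN.
  by rewrite addn0 big_geq // subnn; lia.
rewrite addnS big_nat_recr ?leq_addr //=.
have := IH ltac:(lia); have := Hstep_b (x := l + n) ltac:(lia).
rewrite /Hstep; case: (b _) => /=; lia.
Qed.

(** The first alternative of [lt_cover] expresses that the translate lies below the path, which for
    boxes of D means level 0. *)
Record layered_tiling (P : {set {set box N}}) : Prop := LayeredTiling {
  lt_partition : partition P D;
  lt_ballot : forall T, T \in P -> ballot_tile T;
  lt_anchor : forall T, T \in P -> 0 < tile_rise T -> anchored T;
  lt_cover : forall T, T \in P -> (forall z, z \in T -> level H z = 0) \/
    exists2 T', T' \in P & forall z, z \in T -> exists2 y, y \in T' &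
      y.1 = z.1 :> nat /\ y.2 + 2 = z.2 }.

(** * From a tiling to its run of states *)

Section TilingToRun.
Variable P : {set {set box N}}.
Hypothesis tP : layered_tiling P.

Let coverP : cover P = D. Proof. exact/cover_partition/(lt_partition tP). Qed.
Let trivP : trivIset P. Proof. by case/and3P: (lt_partition tP). Qed.

Lemma tile_sub T z : T \in P -> z \in T -> z \in D.
Proof. by move=> TP zT; rewrite -coverP; apply/bigcupP; exists T. Qed.

(* Two boxes of different levels would persist in the tiles below, down to a
   tile with exactly one of its boxes at level 0, which has no admissible
   translate. *)
Lemma tile_level T z w : T \in P -> z \in T -> w \in T -> level H z = level H w.
Proof.
move kE : (level H z) => k; elim: k T z w kE => [|k IH] T z w kE TP zT wT.
  have [h0|[T' T'P tr]] := lt_cover tP TP; first by rewrite (h0 _ wT).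
  have [y yT' [y1 y2]] := tr _ zT.
  have := tile_sub T'P yT'; have := tile_sub TP zT; rewrite !mem_D /line y1; lia.
have [h0|[T' T'P tr]] := lt_cover tP TP; first by have := h0 _ zT; rewrite kE.
have [y yT' [y1 y2]] := tr _ zT; have [y' y'T' [y'1 y'2]] := tr _ wT.
have yk : level H y = k.
  have := tile_sub T'P yT'; have := tile_sub TP zT; rewrite !mem_D /line y1; lia.
have := IH _ _ _ yk T'P yT' y'T'.
have := tile_sub T'P y'T'; have := tile_sub TP wT; rewrite !mem_D /line y'1; lia.
Qed.

(** The third clause is the ballot condition; the fourth says that a tile ending before column N has
    rise 0. *)
Definition is_segment (T : {set box N}) l r k :=
  [/\ graph_tile (line H k) l r T, forall x, l <= x <= r -> k < h x,
      forall x, l <= x <= r -> H l <= H x & H r = H l \/ r = N].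

Lemma mem_segment T l r k x : T \in P -> graph_tile (line H k) l r T -> x <= N ->
  k < h x -> (cell x k \in T) = (l <= x <= r).
Proof. by move=> TP [_ _ _ ->] xN kh; rewrite inE cell1 // cell2 // eqxx andbT. Qed.

Lemma tile_segment T : T \in P -> exists l r k, is_segment T l r k.
Proof.
move=> TP; have bT := lt_ballot tP TP.
have [f [l [r gT]]] := ballot_tile_is_graph bT.
have [lr rN fN TE] := gT.
have box_in x : l <= x <= r -> ((inord x, inord (f x)) : box N) \in T.
  move=> hx; rewrite TE inE; have ? : x < N.+1 by lia.
  by rewrite !inordK ?ltnS ?fN // eqxx andbT.
pose k := level H ((inord l, inord (f l)) : box N).
have hl : l <= l <= r by lia.
(* By [tile_level] all boxes share the level k of the leftmost one, so the tile follows a translate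
   of the path. *)
have fE x : l <= x <= r -> f x = line H k x /\ k < h x.
  move=> hx; have lv := tile_level TP (box_in _ hl) (box_in _ hx); rewrite -/k in lv.
  have := tile_sub TP (box_in _ hx); rewrite mem_D -lv /=.
  have xN : x < N.+1 by lia.
  by rewrite !inordK ?ltnS ?fN // => /andP[/eqP].
have gT' : graph_tile (line H k) l r T.
  split=> // [x hx|]; first by case: (fE x hx) => <- _; apply: fN.
  rewrite TE; apply/setP => z; rewrite !inE; apply: andb_id2l => hz.
  by case: (fE _ hz) => <-.
have [_ hmin] := (ballot_tile_graph gT').1 bT.
exists l, r, k; split=> // [x /fE[]//|x /hmin|]; first by rewrite /line; lia.
have := lt_anchor tP TP; rewrite (tile_rise_graph gT') (anchored_graph gT').
have : line H k l <= line H k r by apply: hmin; lia.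
rewrite /line; have [->|ne] := eqVneq r N; first by right.
by move=> le an; left; have : ~ 0 < (H r + k.*2.+1) - (H l + k.*2.+1); [by move/an|lia].
Qed.

Definition tile_start x k := start (pblock P (cell x k)).

Lemma tile_at x k : x <= N -> k < h x -> exists r,
  [/\ pblock P (cell x k) \in P, is_segment (pblock P (cell x k)) (tile_start x k) r k
    & tile_start x k <= x <= r].
Proof.
move=> xN kh; have cD : cell x k \in cover P by rewrite coverP cell_in.
have BP := pblock_mem cD; have [l [r [k' sB]]] := tile_segment BP.
have := cD; rewrite -mem_pblock => cB.
have kk : k' = k.
  case: sB => -[_ _ _ e] _ _ _; move: (cB); rewrite e inE => /andP[_ /eqP /level_line <-].
  exact: level_cell.
rewrite kk in sB; have [gB _ _ _] := sB.
exists r; rewrite /tile_start (start_graph gB); split=> //.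
by rewrite -(mem_segment BP gB).
Qed.

(** Level and left end identify a tile: two tiles agreeing in both share the box [cell l k], and
    tiles are disjoint. *)
Lemma same_tile T l r k y : T \in P -> is_segment T l r k -> y <= N ->
  (k < h y /\ tile_start y k = l) <-> l <= y <= r.
Proof.
move=> TP sT yN; have [gT hT _ _] := sT; have [lr rN _ _] := gT.
have lN : l <= N by lia.
have kl : k < h l by apply: hT; lia.
have lT : cell l k \in T by rewrite (mem_segment TP gT) //; lia.
split=> [[ky sy]|hy].
  have [r' [BP [gB hB _ _] hy]] := tile_at yN ky.
  have lB : cell l k \in pblock P (cell y k) by rewrite (mem_segment BP gB) //; lia.
  rewrite -(mem_segment TP gT) // -(def_pblock trivP TP lT) (def_pblock trivP BP lB).
  by rewrite mem_pblock coverP cell_in.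
have ky := hT _ hy; split=> //.
have yT : cell y k \in T by rewrite (mem_segment TP gT).
by rewrite /tile_start (def_pblock trivP TP yT) (start_graph gT).
Qed.

(** Nesting of levels. It suffices to translate the two end boxes, because the tile containing them
    is again a segment. *)
Lemma tile_below T l r k : T \in P -> is_segment T l r k.+1 ->
  exists T' l' r', [/\ T' \in P, is_segment T' l' r' k, l' <= l & r <= r'].
Proof.
move=> TP [gT hT _ _]; have [lr rN _ _] := gT.
have lN : l <= N by lia.
have kl : k.+1 < h l by apply: hT; lia.
have kr : k.+1 < h r by apply: hT; lia.
have lT : cell l k.+1 \in T by rewrite (mem_segment TP gT) //; lia.
have rT : cell r k.+1 \in T by rewrite (mem_segment TP gT) //; lia.
have [h0|[T' T'P tr]] := lt_cover tP TP; first by have := h0 _ lT; rewrite level_cell.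
have below x : x <= N -> k.+1 < h x -> cell x k.+1 \in T -> cell x k \in T'.
  move=> xN kx /tr[y yT' []]; rewrite cell1 // cell2 // /line => y1 y2.
  have lv : level H y = k by have := tile_sub T'P yT'; rewrite mem_D /line y1; lia.
  by rewrite -lv -y1 -cell_level //; apply: tile_sub yT'.
have l' := below _ lN kl lT; have r' := below _ rN kr rT.
have [l1 [r1 [k1 s1]]] := tile_segment T'P; have [g1 _ _ _] := s1.
have kk : k1 = k.
  case: g1 => _ _ _ e; move: (l'); rewrite e inE => /andP[_ /eqP /level_line <-].
  by apply: level_cell => //; lia.
rewrite kk in g1 s1; exists T', l1, r1; split=> //.
  by move: l'; rewrite (mem_segment T'P g1) //; lia.
by move: r'; rewrite (mem_segment T'P g1) //; lia.
Qed.

Definition column x := mkseq (tile_start x) (h x).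

Definition joined x k := (k < h x.+1) && (tile_start x.+1 k <= x).

(** * Transition between adjacent columns *)

Section Step.
Variable x : nat.
Hypothesis xN : x < N.

Lemma joined_tile k : joined x k ->
  [/\ k < h x, tile_start x k = tile_start x.+1 k & H (tile_start x k) <= H x.+1].
Proof.
case/andP => kh le; have [r [BP sB hx]] := tile_at xN kh.
have [kx E] := (same_tile BP sB (ltnW xN)).2 ltac:(lia).
by case: sB => _ _ hm _; rewrite E; split=> //; apply: hm.
Qed.

Lemma joined_below k : joined x k.+1 -> joined x k.
Proof.
case/andP => kh le; have [r [BP sB hx]] := tile_at xN kh.
have [T' [l' [r' [T'P sT' ll rr]]]] := tile_below BP sB.
have [kx E] := (same_tile T'P sT' xN).2 ltac:(lia).
by rewrite /joined kx E; lia.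
Qed.

(** The tile ends in column x, which is not the last one, so it is not anchored and has rise 0. *)
Lemma unjoined_end k : k < h x -> ~~ joined x k -> H (tile_start x k) = H x.
Proof.
move=> kh; have [r [BP sB hx]] := tile_at (ltnW xN) kh.
have [xr|rx] := ltnP x r.
  have [kx E] := (same_tile BP sB xN).2 ltac:(lia).
  by rewrite /joined kx E; lia.
have [_ _ _ er] := sB; have rE : r = x by lia.
by rewrite rE in er; case: er => [->|] //; lia.
Qed.

Lemma unjoined_start k : k < h x.+1 -> ~~ joined x k -> tile_start x.+1 k = x.+1.
Proof.
move=> kh; have [r [BP sB hx]] := tile_at xN kh; rewrite /joined kh; lia.
Qed.

(** By [joined_below] the levels whose tiles continue are closed downwards. *)
Lemma joined_threshold : exists j, forall k, joined x k = (k < j).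
Proof.
have ex : exists k, ~~ joined x k by exists (h x.+1); rewrite /joined ltnn.
exists (ex_minn ex); case: ex_minnP => j nj mj k.
have [lt|le] := ltnP k j; first by apply: contraTT lt => /mj; rewrite -leqNgt.
apply: contraNF nj; move: le => /subnKC <-.
by elim: (k - j) => [|i IH]; rewrite ?addn0 // addnS => /joined_below.
Qed.

Lemma column_succs : column x.+1 \in succs H (b x) x (column x).
Proof.
have [j jE] := joined_threshold.
have j1 : j <= h x.+1.
  by case: j jE => // j jE; have := jE j; rewrite ltnSn => /andP[].
have j0 : j <= h x.
  by case: j jE {j1} => // j jE; have := jE j; rewrite ltnSn => /joined_tile[].
have hs := Hstep_b xN.
(* Levels below j continue. From level j on, the tiles of column x end there and those of the next
   column start there. *)
apply: succs_intro; exists j (h x.+1 - j); rewrite ?size_mkseq ?subnKC //.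
- apply: (@eq_from_nth _ 0).
    by rewrite size_cat size_nseq size_takel ?size_mkseq ?subnKC.
  move=> k; rewrite size_mkseq => kh; rewrite nth_mkseq // nth_cat size_takel ?size_mkseq //.
  have := jE k; case: ltnP => [lt|le] jk.
    by have [kx <- _] := joined_tile jk; rewrite nth_take // nth_mkseq.
  by rewrite nth_nseq ltn_sub2r ?unjoined_start ?jk //; lia.
- apply/(all_nthP 0) => i; rewrite size_drop size_mkseq nth_drop => ih.
  rewrite nth_mkseq; last by lia.
  by rewrite unjoined_end // ?jE; lia.
- case: (b x) hs => //= hs; apply/(all_nthP 0) => i; rewrite size_takel ?size_mkseq // => ij.
  rewrite nth_take // nth_mkseq; last by lia.
  have := jE i; rewrite ij => /joined_tile[_ _]; lia.
by have := gap_step xN; case: (b x); lia.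
Qed.

Lemma step_art_column : step_art (b x) x (column x) (column x.+1) =
  \sum_(k < h x) (~~ b x || ~~ joined x k).
Proof.
rewrite /step_art size_mkseq; case: (b x) => /=; last by rewrite sum1_card card_ord.
have [j jE] := joined_threshold.
have cE n : \sum_(k < n) ~~ joined x k = n - j.
  elim: n => [|n IH]; first by rewrite big_ord0.
  by rewrite big_ord_recr /= IH jE; lia.
rewrite cE; congr (_ - _).
have [j1 j0] : j <= h x.+1 /\ j <= h x.
  case: j jE {cE} => // j jE; have := jE j; rewrite ltnSn => J.
  by have [-> _ _] := joined_tile J; move: J; rewrite /joined => /andP[-> _].
rewrite /column /mkseq count_map -size_filter.
rewrite (eq_in_filter (a2 := fun k => k < j)); last first.
  by move=> k; rewrite mem_iota -jE /joined /= => ->.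
rewrite size_filter -(subnKC j1) iotaD count_cat.
rewrite (eq_in_count (a2 := predT)) ?count_predT ?size_iota; last by move=> k; rewrite mem_iota.
by rewrite (eq_in_count (a2 := pred0)) ?count_pred0 ?addn0 // => k; rewrite mem_iota /=; lia.
Qed.

End Step.

(** Double counting: a statistic of tiles that is a sum over boxes can be summed by columns. *)
Lemma sum_tiles (g : box N -> nat) w : (forall T, T \in P -> w T = \sum_(z in T) g z) ->
  \sum_(T in P) w T = \sum_(x < N.+1) \sum_(k < h x) g (cell x k).
Proof.
move=> wE; rewrite (eq_bigr _ wE) -sum_layered; apply/esym.
exact: set_partition_big (lt_partition tP).
Qed.

Lemma sum_segment T l r k (g : box N -> nat) : T \in P -> is_segment T l r k ->
  \sum_(z in T) g z = \sum_(l <= x < r.+1) g (cell x k).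
Proof.
move=> TP [gT hT _ _]; have [lr rN _ TE] := gT.
rewrite -(big_map (fun x => cell x k) xpredT g) -big_filter; apply: perm_big; apply: uniq_perm.
- by rewrite filter_uniq // index_enum_uniq.
- rewrite map_inj_in_uniq ?iota_uniq // => x y; rewrite !mem_index_iota => hx hy e.
  by rewrite -(@cell1 x k) ?e ?cell1 //; lia.
move=> z; rewrite mem_filter mem_index_enum andbT; apply/idP/mapP.
  move=> zT; exists (z.1 : nat).
    by move: zT; rewrite TE inE mem_index_iota ltnS => /andP[].
  rewrite {1}(cell_level (tile_sub TP zT)); congr cell; apply: level_line.
  by move: zT; rewrite TE inE => /andP[_ /eqP].
by move=> [x]; rewrite mem_index_iota ltnS => hx ->; rewrite (mem_segment TP gT) //;
  [lia|apply: hT].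
Qed.

(** An anchored tile has exactly one box in the last column, and any other tile has none. *)
Lemma tiles2_column : tiles2 P = size (column N).
Proof.
rewrite size_mkseq /tiles2 -sum1_card (eq_bigl (fun T => (T \in P) && anchored T)); last first.
  by move=> T; rewrite inE.
rewrite big_mkcondr /= (sum_tiles (g := fun z => z.1 == N :> nat)); last first.
  move=> T TP; have [l [r [k sT]]] := tile_segment TP; rewrite (sum_segment _ TP sT).
  have [gT _ _ _] := sT; have [lr rN _ _] := gT; rewrite (anchored_graph gT).
  rewrite big_nat_recr //= big1_seq ?add0n ?cell1 //.
  move=> x; rewrite mem_index_iota /= => hx; have xN : x < N by lia.
  by rewrite cell1 ?(ltnW xN) // ltn_eqF.
rewrite big_ord_recr /= big1 ?add0n => [|x _].
  by rewrite (eq_bigr (fun=> 1)) ?sum1_card ?card_ord // => k _; rewrite cell1 ?eqxx.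
by rewrite big1 // => k _; rewrite cell1 /= ?(ltn_eqF (ltn_ord x)) // ltnW.
Qed.

(* Each box not in the last column is charged 1 when it precedes a D step or
   ends its tile; a tile then collects its D steps, plus 1 if not anchored. *)
Lemma art_III_column :
  art_III P = \sum_(x < N) step_art (b x) x (column x) (column x.+1).
Proof.
rewrite /art_III (sum_tiles (g := fun z => (z.1 < N) && (~~ b z.1 || ~~ joined z.1 (level H z)))).
  rewrite big_ord_recr /= [X in _ + X]big1 ?addn0; last by move=> k _; rewrite cell1 // ltnn.
  apply: eq_bigr => x _; have xN := ltn_ord x; rewrite step_art_column //; apply: eq_bigr => k _.
  by rewrite cell1 ?level_cell ?xN //; apply: ltnW.
move=> T TP; have [l [r [k sT]]] := tile_segment TP; rewrite (sum_segment _ TP sT).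
have [gT hT hm hr] := sT; have [lr rN _ _] := gT.
rewrite (anchored_graph gT) /tile_half (tile_rise_graph gT) (card_graph gT).
have := height_gain lr rN; have : H l <= H r by apply: hm; lia.
rewrite big_nat_recr //= cell1 // level_cell //; last by apply: hT; lia.
have -> : \sum_(l <= i < r) ((cell i k).1 < N) && (~~ b (cell i k).1 ||
    ~~ joined (cell i k).1 (level H (cell i k))) = \sum_(l <= i < r) ~~ b i.
  rewrite big_nat_cond [RHS]big_nat_cond; apply: eq_bigr => x /andP[hx _].
  have xN : x < N by lia.
  have kx : k < h x by apply: hT; lia.
  rewrite !cell1 ?(ltnW xN) // level_cell ?(ltnW xN) // xN.
  have [k1 E] := (same_tile TP sT xN).2 ltac:(lia).
  by rewrite /joined k1 E (_ : l <= x) ?orbF //; lia.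
have -> : (r < N) && (~~ b r || ~~ joined r k) = (r != N).
  have [rE|rN'] := eqVneq r N; first by rewrite rE ltnn.
  have rlN : r < N by lia.
  rewrite rlN /=; case jE : (joined r k); last by rewrite orbT.
  have [kr e _] := joined_tile rlN jE; case/andP: jE => k1 _.
  have [_ e'] := (same_tile TP sT rN).2 ltac:(lia).
  by have := (same_tile TP sT rlN).1 (conj k1 (etrans (esym e) e')); lia.
move: (\sum_(_ <= _ < _) _) => n; rewrite /line; case: eqP => _ /=; lia.
Qed.

End TilingToRun.

(** * From a run of states to its tiling *)

Section RunToTiling.
Variable cs : nat -> seq nat.
Hypothesis cs0 : cs 0 = [::].
Hypothesis cs_succs : forall x, x < N -> cs x.+1 \in succs H (b x) x (cs x).
Hypothesis size_cs : forall x, x <= N -> size (cs x) = h x.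

Lemma cs_inv x : x <= N -> state_inv H x (cs x).
Proof.
elim: x => [|x IH] xN; first by rewrite cs0.
exact: state_inv_succs (Hstep_b xN) (IH (ltnW xN)) (cs_succs xN).
Qed.

Definition origin x k := nth 0 (cs x) k.

Lemma origin_le x k : x <= N -> k < h x -> origin x k <= x.
Proof.
move=> xN kh; have [_ /allP al _ _] := cs_inv xN.
by apply: (al (origin x k)); rewrite mem_nth ?size_cs.
Qed.

Lemma origin_step x k : x < N -> k < h x ->
  (k < h x.+1 /\ origin x.+1 k = origin x k) \/ H (origin x k) = H x.
Proof.
move=> xN kh; have [j e jle csE hj _ _] := mem_succs (cs_inv (ltnW xN)) (cs_succs xN).
have [kj|jk] := ltnP k j.
  left; rewrite -size_cs // /origin csE size_cat nth_cat size_takel // kj nth_take //.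
  by split=> //; apply: leq_trans kj _; apply: leq_addr.
right; have := allP hj (origin x k); rewrite -(subnKC jk) /origin -nth_drop mem_nth; last first.
  by rewrite size_drop size_cs ?(ltnW xN) // ltn_sub2r //; lia.
by move=> /(_ isT)/eqP.
Qed.

Lemma origin_back x k : x < N -> k < h x.+1 -> origin x.+1 k <= x ->
  k < h x /\ origin x.+1 k = origin x k.
Proof.
move=> xN kh; have [j e jle csE _ _ _] := mem_succs (cs_inv (ltnW xN)) (cs_succs xN).
move: kh; rewrite -!size_cs ?(ltnW xN) // /origin csE size_cat size_nseq size_takel // => kh.
rewrite nth_cat size_takel //; case: ltnP => [kj _|jk].
  by rewrite nth_take //; split=> //; apply: leq_trans kj jle.
by rewrite nth_nseq ltn_subLR // kh ltnn.
Qed.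

Lemma origin_range x k y : x <= N -> k < h x -> origin x k <= y <= x ->
  k < h y /\ origin y k = origin x k.
Proof.
elim: x => [|x IH] xN kh; first by rewrite leqn0 => /andP[_ /eqP ->].
case/andP => oy; rewrite leq_eqVlt => /orP[/eqP -> //|yx].
have [kh' E] := origin_back xN kh (leq_trans oy yx).
by rewrite E; apply: IH => //; [apply: ltnW|rewrite -E oy].
Qed.

Lemma origin_sorted x k : x <= N -> k.+1 < h x -> origin x k <= origin x k.+1.
Proof.
move=> xN kh; have [s _ _ _] := cs_inv xN.
by apply: (sorted_ltn_nth leq_trans 0 s); rewrite ?inE ?size_cs // ltnW.
Qed.

Lemma H_origin x k : x <= N -> k < h x -> H (origin x k) <= H x.
Proof.
move=> xN kh; have [_ _ _ /allP al] := cs_inv xN.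
by apply: (al (origin x k)); rewrite mem_nth ?size_cs.
Qed.

(** Left end and level determine a tile, so the tiles are recovered as the fibres of this map. *)
Definition label (z : box N) := (origin z.1 (level H z), level H z).

Definition class z := [set w in D | label z == label w].

Lemma class_segment z : z \in D ->
  exists r, is_segment (class z) (origin z.1 (level H z)) r (level H z) /\ z.1 <= r.
Proof.
move=> zD; set l := origin _ _; set k := level H z.
have zN : z.1 <= N by rewrite -ltnS ltn_ord.
have kz : k < h z.1 by move: zD; rewrite mem_D => /andP[].
pose p y := [&& y <= N, k < h y & origin y k == l].
have pz : p z.1 by rewrite /p zN kz /l eqxx.
have exp : exists y, p y by exists z.1.
have pN y : p y -> y <= N by case/and3P.
(* The right end is the last column in which the left end l occurs at level k. *)
pose r := ex_maxn exp pN.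
have [pr rmax] : p r /\ forall y, p y -> y <= r by rewrite /r; case: ex_maxnP.
case/and3P: (pr) => rN kr /eqP lr.
have range y : l <= y <= r -> k < h y /\ origin y k = l.
  by rewrite -lr => hy; apply: origin_range.
have lz : l <= z.1 by apply: origin_le.
exists r; split; last exact: rmax.
split.
- split=> //; first exact: leq_trans lz (rmax _ pz).
    by move=> x /[dup] hx /range[kx _]; apply: line_le => //; lia.
  apply/setP => w; rewrite !inE mem_D /label -/k -/l xpair_eqE.
  have wN : w.1 <= N by rewrite -ltnS ltn_ord.
  apply/idP/idP => [/andP[/andP[/eqP e lh] /andP[/eqP o /eqP kE]]|/andP[hw /eqP e]].
    rewrite -kE in e lh o; rewrite e eqxx andbT.
    rewrite rmax ?andbT; last by rewrite /p wN lh -o /= eqxx.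
    by rewrite o; apply: origin_le.
  have [kw ow] := range _ hw; have kE := level_line e.
  by rewrite kE e !eqxx kw ow eqxx.
- by move=> x /range[].
- by move=> x /[dup] hx /range[kx <-]; apply: H_origin => //; lia.
have [->|ne] := eqVneq r N; [by right|left].
have rlN : r < N by lia.
(* By maximality of r the tile does not continue, so it was dropped, which requires its left end to
   have height [H r]. *)
case: (origin_step rlN kr) => [[k1 o1]|<-]; last by rewrite lr.
by have := rmax r.+1; rewrite /p rlN k1 o1 lr eqxx => /(_ isT); rewrite ltnn.
Qed.

Definition run_tiling := preim_partition label D.

Lemma mem_run_tiling T : T \in run_tiling -> exists2 z, z \in D & T = class z.
Proof. by move=> /imsetP[z zD ->]; exists z. Qed.

Lemma class_run_tiling z : z \in D -> class z \in run_tiling.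
Proof. by move=> zD; apply/imsetP; exists z. Qed.

Lemma line_step k x : x < N -> line H k x.+1 = line H k x + 1 \/ line H k x.+1 + 1 = line H k x.
Proof. by move=> xN; have := Hstep_b xN; rewrite /Hstep /line; case: (b x); lia. Qed.

Lemma run_tiling_layered : layered_tiling run_tiling.
Proof.
split; first exact: preim_partitionP.
- move=> T /mem_run_tiling[z zD ->]; have [r [[gT hT hm hr] zr]] := class_segment zD.
  apply/(ballot_tile_graph gT); split=> x hx; last by rewrite /line leq_add2r; apply: hm.
  by apply: line_step; case: gT => _ rN _ _; lia.
- move=> T /mem_run_tiling[z zD ->]; have [r [[gT hT hm hr] zr]] := class_segment zD.
  rewrite (tile_rise_graph gT) (anchored_graph gT) /line.
  by case: hr => [->|->]; rewrite ?subnn ?eqxx.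
move=> T /mem_run_tiling[z zD ->]; have [r [[gT hT hm hr] zr]] := class_segment zD.
case kE : (level H z) gT hT => [|k] gT hT.
  by left=> w; rewrite inE => /andP[_ /eqP[_ <-]].
right; have [lr rN _ _] := gT.
have kr : k.+1 < h r by apply: hT; rewrite lr leqnn.
have rz : origin r k.+1 = origin z.1 k.+1.
  have : cell r k.+1 \in class z.
    by case: gT => _ _ _ ->; rewrite inE cell1 // cell2 // eqxx lr leqnn.
  by rewrite inE => /andP[_ /eqP[]]; rewrite kE cell1 // level_cell // => ->.
(* The tile one level lower through column r covers the translate: states are sorted, so its left
   end is no further right. *)
exists (class (cell r k)); first by apply: class_run_tiling; rewrite cell_in // ltnW.
move=> w; case: gT => _ _ _ ->; rewrite inE => /andP[hw /eqP e].
have wN : w.1 <= N by rewrite -ltnS ltn_ord.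
have kr' : k < h r by apply: ltnW.
have [kw ow] : k < h w.1 /\ origin w.1 k = origin r k.
  case/andP: hw => lw wr; apply: origin_range => //; rewrite wr andbT.
  by apply: leq_trans (origin_sorted rN kr) _; rewrite rz.
exists (cell w.1 k); last first.
  by rewrite cell1 // cell2 // e /line; split=> //; rewrite doubleS !addnS addn0.
by rewrite inE cell_in // /label !cell1 // !level_cell // ow eqxx.
Qed.

Lemma column_run_tiling x : x <= N -> column run_tiling x = cs x.
Proof.
move=> xN; apply: (@eq_from_nth _ 0); first by rewrite size_mkseq size_cs.
move=> k; rewrite size_mkseq => kh; rewrite nth_mkseq // /tile_start.
have cD := cell_in xN kh; have tiv : trivIset run_tiling.
  by case/and3P: (preim_partitionP label D).
rewrite (def_pblock tiv (class_run_tiling cD)); last by rewrite inE cD eqxx.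
have [r [[gT _ _ _] _]] := class_segment cD.
by rewrite (start_graph gT) cell1 // level_cell.
Qed.

End RunToTiling.

(** Membership in a tile is decided by data stored in the columns; this makes the passage to runs
    injective. *)
Lemma same_label P T z w : layered_tiling P -> T \in P -> z \in T -> w \in D ->
  (w \in T) = (level H z == level H w) &&
    (tile_start P z.1 (level H z) == tile_start P w.1 (level H w)).
Proof.
move=> tP TP zT wD; have [l [r [k sT]]] := tile_segment tP TP; have [gT hT _ _] := sT.
have zD := tile_sub tP TP zT.
have zN : z.1 <= N by rewrite -ltnS ltn_ord.
have wN : w.1 <= N by rewrite -ltnS ltn_ord.
have kw : level H w < h w.1 by move: wD; rewrite mem_D => /andP[].
have memE (v : box N) : v \in T -> level H v = k /\ l <= v.1 <= r.
  by case: gT => _ _ _ ->; rewrite inE => /andP[hv /eqP /level_line].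
have [kz hz] := memE z zT; rewrite kz.
have [_ sz] := (same_tile tP TP sT zN).2 hz; rewrite sz.
apply/idP/andP => [/memE[kw' hw]|[/eqP kE /eqP lE]].
  by rewrite kw' eqxx; have [_ ->] := (same_tile tP TP sT wN).2 hw.
rewrite (cell_level wD) -kE (mem_segment TP gT) ?kE //.
by apply/(same_tile tP TP sT wN); rewrite kE -lE.
Qed.

Lemma column_inj P P' : layered_tiling P -> layered_tiling P' ->
  (forall x, x <= N -> column P x = column P' x) -> P = P'.
Proof.
have sub Q Q' : layered_tiling Q -> layered_tiling Q' ->
    (forall x, x <= N -> column Q x = column Q' x) -> Q \subset Q'.
  move=> tQ tQ' cE; have sE (w : box N) : w \in D ->
      tile_start Q w.1 (level H w) = tile_start Q' w.1 (level H w).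
    rewrite mem_D => /andP[_ kw]; have wN : w.1 <= N by rewrite -ltnS ltn_ord.
    by have := congr1 (nth 0 ^~ (level H w)) (cE _ wN); rewrite /= !nth_mkseq.
  apply/subsetP => T TQ; have [l [r [k sT]]] := tile_segment tQ TQ.
  have [gT hT _ _] := sT; have [lr rN _ _] := gT.
  have kl : k < h l by apply: hT; rewrite lr leqnn.
  have lN : l <= N by apply: leq_trans lr rN.
  have lT : cell l k \in T by rewrite (mem_segment TQ gT) // lr leqnn.
  have lD := cell_in lN kl.
  have cQ' : cover Q' = D by apply/cover_partition/(lt_partition tQ').
  have T'Q : pblock Q' (cell l k) \in Q' by rewrite pblock_mem // cQ'.
  have lT' : cell l k \in pblock Q' (cell l k) by rewrite mem_pblock cQ'.
  suff -> : T = pblock Q' (cell l k) by [].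
  apply/setP => w; have [wD|wD] := boolP (w \in D).
    by rewrite (same_label tQ TQ lT wD) (same_label tQ' T'Q lT' wD) !sE.
  have out (Q0 : {set {set box N}}) (T0 : {set box N}) :
      layered_tiling Q0 -> T0 \in Q0 -> (w \in T0) = false.
    move=> t0 T0in; apply/negP => wT; case/negP: wD.
    exact: (@tile_sub Q0 t0 T0 w T0in wT).
  by rewrite (out Q) ?(out Q').
move=> tP tP' cE; apply/eqP; rewrite eqEsubset !sub // => x xN; exact/esym/cE.
Qed.

End LayeredTilings.

(** * Generating functions *)

Section BallotTilings.
Variable lam : seq bool.
Hypothesis bl : ballot lam.
Let N := size lam.
Let H := ht lam.
Let b := nth false lam.
Let Hb x : x < N -> Hstep H (b x) x := ht_step bl (x := x).

Section FixedUpperPath.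
Variable mu : seq bool.
Hypotheses (smu : size mu = N) (ab : above lam mu).
Let h := half_gap lam mu.
Let D : {set box N} := skewS lam mu.

Let gap_le x : x <= N -> H x + (h x).*2 <= x.
Proof. by move=> xN; rewrite -(half_gapE smu _ ab) //; apply: ht_le. Qed.

Let gap_step x : x < N ->
  if b x then h x.+1 = h x \/ (h x.+1).+1 = h x else h x.+1 = h x \/ h x.+1 = (h x).+1.
Proof. exact: half_gap_step. Qed.

Let layD : layered H h D := skewS_layered smu bl ab.

Lemma ballot_tilingP (P : {set {set box N}}) :
  reflect (layered_tiling H D P) (ballot_tiling lam mu P && cover_inclusive lam P).
Proof.
have lev0 (z : box N) : z \in D ->
    ((Posz (ctr z).2 - 1 <= height lam (ctr z).1)%R) = (level H z == 0).
  rewrite (mem_D layD) => /andP[/eqP e _]; rewrite /ctr /= ballot_height ?e /line //.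
    by rewrite /H; move: (ht lam _) (level _ _) => u k; lia.
  by rewrite -ltnS ltn_ord.
have subD (T : {set box N}) z : partition P D -> T \in P -> z \in T -> z \in D.
  by move=> /cover_partition <- TP zT; apply/bigcupP; exists T.
apply: (iffP andP) => [[/and3P[pP /forall_inP bT /forall_inP aT] /forall_inP cI]|[pP bT aT cI]].
  split=> // [T TP|T TP]; first exact/implyP/aT.
  case/orP: (cI T TP) => [/forall_inP z0|/existsP[T' /andP[T'P /forall_inP tr]]].
    left=> z zT; apply/eqP; rewrite -lev0; [exact: z0|exact: subD zT].
  right; exists T' => // z /tr /existsP[y /and3P[yT' /eqP y1 /eqP y2]].
  by exists y.
split; first by apply/and3P; split=> //; apply/forall_inP => T TP; [apply: bT|apply/implyP/aT].
apply/forall_inP => T TP; apply/orP; case: (cI T TP) => [z0|[T' T'P tr]]; [left|right].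
  by apply/forall_inP => z zT; rewrite lev0 ?z0 //; apply: subD zT.
apply/existsP; exists T'; rewrite T'P; apply/forall_inP => z /tr[y yT' [y1 y2]].
by apply/existsP; exists y; rewrite yT' /ctr /= y1 y2 !eqxx.
Qed.

(** Column 0 is omitted: its state is always empty and serves as the initial state of the run. *)
Definition code (P : {set {set box N}}) := mkseq (fun i => column H h P i.+1) N.

Lemma column0 (P : {set {set box N}}) : column H h P 0 = [::].
Proof.
have h0 : h 0 = 0 by have := gap_le (leq0n _); lia.
by rewrite /column h0.
Qed.

Lemma nth_code (P : {set {set box N}}) i : i <= N -> nth [::] ([::] :: code P) i = column H h P i.
Proof. by case: i => [|i] iN; rewrite ?column0 //= nth_mkseq. Qed.

Section Tiling.
Variable P : {set {set box N}}.
Hypothesis tP : layered_tiling H D P.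

Lemma code_run : code P \in runs H lam 0 [::].
Proof.
apply/mem_runs; rewrite size_mkseq; split=> // i iN.
rewrite !nth_code ?(ltnW iN) // add0n.
exact: (column_succs Hb gap_le gap_step layD tP).
Qed.

Lemma code_weight (R : comPzRingType) (q t : R) :
  run_weight q t lam 0 [::] (code P) = (q ^+ art_III P * t ^+ tiles2 P)%R.
Proof.
rewrite run_weightE ?size_mkseq // nth_code // (tiles2_column gap_le layD tP).
rewrite (art_III_column Hb gap_le layD tP).
congr (_ ^+ _ * _)%R; apply: eq_bigr => i _.
by rewrite !nth_code ?(ltnW (ltn_ord i)).
Qed.

End Tiling.
End FixedUpperPath.

Lemma code_inj mu mu' (P P' : {set {set box N}}) :
  size mu = N -> size mu' = N -> above lam mu -> above lam mu' ->
  layered_tiling H (skewS lam mu) P -> layered_tiling H (skewS lam mu') P' ->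
  code mu P = code mu' P' -> mu = mu' /\ P = P'.
Proof.
move=> smu smu' ab ab' tP tP' cE.
have colE x : x <= N -> column H (half_gap lam mu) P x = column H (half_gap lam mu') P' x.
  by move=> xN; rewrite -!nth_code // cE.
(* Column sizes give the gap to lambda, hence the upper path. *)
have gapE x : x <= N -> half_gap lam mu x = half_gap lam mu' x.
  by move=> /colE/(congr1 size); rewrite !size_mkseq.
have muE : mu = mu'.
  apply: height_inj => [|x]; first by rewrite smu.
  have bm := above_ballot smu bl ab; have bm' := above_ballot smu' bl ab'.
  rewrite smu => xN; rewrite !ballot_height ?smu ?smu' //.
  by rewrite (half_gapE smu bl ab) // (half_gapE smu' bl ab') // gapE.
split=> //; rewrite -muE in tP' colE.
have gl x : x <= N -> H x + (half_gap lam mu x).*2 <= x.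
  by move=> xN; rewrite -(half_gapE smu _ ab) //; apply: ht_le.
exact: (column_inj gl (skewS_layered smu bl ab) tP tP' colE).
Qed.

Lemma code_surj r : r \in runs H lam 0 [::] ->
  exists mu (P : {set {set box N}}), [/\ size mu = N, above lam mu,
    layered_tiling H (skewS lam mu) P & code mu P = r].
Proof.
move=> /mem_runs[sr rS]; pose cs x := nth [::] ([::] :: r) x.
have csS x : x < N -> cs x.+1 \in succs H (b x) x (cs x) by apply: rS.
have inv x : x <= N -> state_inv H x (cs x) by apply: (cs_inv Hb).
have szS x : x < N -> if b x then size (cs x.+1) = size (cs x) \/ (size (cs x.+1)).+1 = size (cs x)
    else size (cs x.+1) = size (cs x) \/ size (cs x.+1) = (size (cs x)).+1.
  move=> xN; have [j e jle -> _ _] := mem_succs (inv x (ltnW xN)) (csS x xN).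
  by rewrite size_cat size_nseq size_takel //; case: (b x).
(* The upper path copies the step of lambda when the number of levels is unchanged and takes the
   opposite step otherwise. *)
pose mu := mkseq (fun x => b x == (size (cs x.+1) == size (cs x))) N.
have smu : size mu = N by rewrite size_mkseq.
have muh x : x <= N -> height mu x = (height lam x + Posz (size (cs x)).*2)%R.
  elim: x => [|x IH] xN; first by rewrite !height0.
  rewrite !heightS ?smu // IH ?(ltnW xN) // nth_mkseq // -/(b x).
  by have := szS x xN; case: (b x); case: eqP => //=; lia.
have ab : above lam mu.
  by apply/forallP => x; rewrite muh -1?ltnS //; lia.
have gapE x : x <= N -> half_gap lam mu x = size (cs x).
  move=> xN; have := muh x xN; have bm := above_ballot smu bl ab.
  rewrite !ballot_height ?smu // (half_gapE smu bl ab) //; lia.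
have gl x : x <= N -> H x + (half_gap lam mu x).*2 <= x.
  by move=> xN; rewrite -(half_gapE smu _ ab) //; apply: ht_le.
have lay := skewS_layered smu bl ab.
have cs0 : cs 0 = [::] by [].
have szE x : x <= N -> size (cs x) = half_gap lam mu x by move=> /gapE ->.
exists mu, (run_tiling H (skewS lam mu) cs); split=> //.
  exact: (run_tiling_layered Hb gl lay cs0 csS szE).
apply: (@eq_from_nth _ [::]); first by rewrite size_mkseq.
move=> i; rewrite size_mkseq => iN.
by rewrite nth_mkseq // (column_run_tiling Hb gl lay cs0 csS szE).
Qed.

Local Open Scope ring_scope.

Lemma P_III_runs (R : comPzRingType) (q t : R) :
  P_III q t lam = \sum_(r <- runs H lam 0 [::]) run_weight q t lam 0 [::] r.
Proof.
rewrite /P_III pair_big_dep /=.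
pose ok (a : (size lam).-tuple bool * {set {set box (size lam)}}) :=
  above lam a.1 && (ballot_tiling lam a.1 a.2 && cover_inclusive lam a.2).
transitivity (\sum_(r <- [seq code (tval a.1) a.2 | a <- index_enum _ & ok a]) run_weight q t lam 0 [::] r).
  rewrite big_map big_filter; apply: eq_bigr => -[mu P] /andP[/= ab].
  by move=> /(ballot_tilingP (size_tuple mu) ab) tP; rewrite (code_weight (size_tuple mu) ab).
apply/perm_big/uniq_perm.
- rewrite map_inj_in_uniq ?filter_uniq ?index_enum_uniq // => -[mu P] [mu' P'].
  rewrite !mem_filter => /andP[/andP[/= ab tP] _] /andP[/andP[/= ab' tP'] _] cE.
  move/(ballot_tilingP (size_tuple mu) ab): tP => tP.
  move/(ballot_tilingP (size_tuple mu') ab'): tP' => tP'.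
  by have [/val_inj -> ->] := code_inj (size_tuple mu) (size_tuple mu') ab ab' tP tP' cE.
- exact: runs_uniq.
move=> r; apply/mapP/idP => [[[mu P]]|/code_surj[mu [P [smu ab tP <-]]]].
  rewrite mem_filter => /andP[/andP[/= ab /(ballot_tilingP (size_tuple mu) ab) tP] _] ->.
  exact: (code_run (size_tuple mu) ab).
have smu' : size mu == N by apply/eqP.
exists (Tuple smu', P) => //; rewrite mem_filter mem_index_enum andbT /ok /= ab /=.
exact/ballot_tilingP.
Qed.

Lemma P_III_chains (R : comPzRingType) (q t : R) :
  P_III q t lam = chains q lam [:: 0%N] * \prod_(i < n_D lam) (1 + q ^+ i * t).
Proof.
have e0 : H 0 = 0%N := ht0 lam.
rewrite P_III_runs sum_runs //; last by rewrite e0 ballot_stays_nonneg.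
(* For d_0 = 0 the basis element is the constant 1, so the functional returns the value at
   multiplicity 0, the empty initial state. *)
rewrite e0 -[RHS](_ : mev q (blocks 0 [:: 0%N]) (wmult q t lam) = _) //.
rewrite mev_wmult ?ballot_stays_nonneg // add0n.
by rewrite -(big_mkord xpredT (fun i => 1 + q ^+ i * t)) /index_iota subn0.
Qed.

End BallotTilings.

(** * Dyck tilings as the case t = 0 *)

Section DyckTilings.
Variable nu : seq bool.
Hypothesis dnu : dyck nu.
Let bnu : ballot nu. Proof. by case/andP: dnu. Qed.
Let N := size nu.

Let ht_end : ht nu N = 0.
Proof. by case/andP: dnu => _ /eqP; rewrite ballot_height // => -[]. Qed.

Lemma dyck_above mu : size mu = N -> above nu mu -> dyck mu = (half_gap nu mu N == 0).
Proof.
move=> smu ab; have bm := above_ballot smu bnu ab.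
rewrite /dyck bm smu ballot_height ?smu // (half_gapE smu bnu ab) // ht_end; lia.
Qed.

(** A Dyck path has height at most N - x in column x, so the right boundary condition of [inY] holds
    for every box below mu. *)
Lemma skewY_skewS mu : size mu = N -> above nu mu -> dyck mu -> skewY nu mu = skewS nu mu.
Proof.
move=> smu ab dm; have bm := above_ballot smu bnu ab.
have end0 : ht mu N = 0.
  by case/andP: dm => _ /eqP; rewrite ballot_height ?smu // => -[].
have tail x : x <= N -> ht mu x + x <= N.
  move=> xN; have -> : x = N - (N - x) by lia.
  elim: (N - x) => [|k IH]; first by rewrite subn0 end0.
  have [lt|ge] := ltnP k N; last by move: IH; rewrite (_ : N - k.+1 = N - k) //; lia.
  have := @ht_step mu (N - k.+1) bm; rewrite smu /Hstep (_ : (N - k.+1).+1 = N - k); last by lia.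
  move=> /(_ ltac:(lia)); case: (nth _ _ _); lia.
apply/setP => -[x y]; rewrite !inE /inY /inS /ctr /= smu.
have xN : x <= N by rewrite -ltnS ltn_ord.
rewrite !ballot_height ?smu //; have := tail x xN; have := ht_le mu x.
have := @odd_ht mu x bm; rewrite smu => /(_ xN).
move: (ht nu x) (ht mu x) => u v; rewrite -/N.
move: (nat_of_ord x) (nat_of_ord y) xN => {}x {}y xN od.
rewrite xN oddD -od.
rewrite (_ : (Posz u + 1 <= Posz y)%R = (u < y)); last by lia.
rewrite (_ : (Posz v + 1 <= Posz y)%R = (v < y)); last by lia.
lia.
Qed.

Lemma dyck_tilingE mu (P : {set {set box N}}) : size mu = N -> above nu mu -> dyck mu ->
  dyck_tiling nu mu P = (ballot_tiling nu mu P && cover_inclusive nu P)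
  /\ (ballot_tiling nu mu P && cover_inclusive nu P -> tiles2 P = 0 /\ art_dyck P = art_III P).
Proof.
move=> smu ab dm; have Hb x : x < N -> Hstep (ht nu) (nth false nu x) x by apply: ht_step.
have gl x : x <= N -> ht nu x + (half_gap nu mu x).*2 <= x.
  by move=> xN; rewrite -(half_gapE smu _ ab) //; apply: ht_le.
have lay := skewS_layered smu bnu ab.
(* The two paths meet at the end, so the last column is empty; without anchored tiles every rise is
   0. *)
have t0 : ballot_tiling nu mu P && cover_inclusive nu P -> tiles2 P = 0.
  move=> /(ballot_tilingP bnu smu ab) tP; rewrite (tiles2_column gl lay tP) size_mkseq.
  by apply/eqP; rewrite -dyck_above.
have unanchored : ballot_tiling nu mu P && cover_inclusive nu P ->
    forall T, T \in P -> anchored T = false.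
  move=> /t0 /eqP; rewrite /tiles2 cards_eq0 => /eqP/setP e T TP.
  by have := e T; rewrite !inE TP.
split.
  rewrite /dyck_tiling /ballot_tiling skewY_skewS //.
  apply/and3P/idP => [[pP /forall_inP dT cI]|ok].
    rewrite pP cI andbT /=; apply/andP; split; apply/forall_inP => T /dT /andP[//].
    by move=> _ /eqP ->.
  case/andP: (ok) => /and3P[pP /forall_inP bT /forall_inP aT] cI; split=> //.
  apply/forall_inP => T TP; rewrite /dyck_tile bT //= eqn0Ngt.
  by have := aT T TP; rewrite unanchored // implybF.
move=> ok; split; first exact: t0.
have tP := elimT (ballot_tilingP bnu smu ab P) ok.
rewrite /art_dyck /art_III -sum1_card -big_split /=.
(* The comparison is made before halving: an unanchored tile of 2n + 1 boxes contributes 2(n +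
   1). *)
suff -> : \sum_(T in P) (#|T| + 1) =
    (\sum_(T in P) (if anchored T then tile_half T else (tile_half T).+1)) * 2 by rewrite mulnK.
rewrite big_distrl /=; apply: eq_bigr => T TP; have un := unanchored ok T TP; rewrite un.
have [l [r [k [gT hT hm hr]]]] := tile_segment lay tP TP; have [lr rN _ _] := gT.
rewrite (anchored_graph gT) in un.
have er : ht nu r = ht nu l by case: hr => // rE; rewrite rE eqxx in un.
have := height_gain Hb lr rN.
rewrite /tile_half (tile_rise_graph gT) (card_graph gT) /line er; lia.
Qed.

Local Open Scope ring_scope.

(** The number of anchored tiles is half the final gap, so 0 to that power is 1 when mu is a Dyck
    path and 0 otherwise. *)
Lemma P_Dyck_P_III (R : comPzRingType) (q : R) : P_Dyck q nu = P_III q 0 nu.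
Proof.
rewrite /P_Dyck /P_III [RHS](bigID (fun mu => dyck (tval mu))) /=.
rewrite [X in _ + X]big1 ?addr0 => [|mu /andP[ab]]; last first.
  rewrite (dyck_above (size_tuple mu) ab) => g0.
  rewrite big1 // => P /(ballot_tilingP bnu (size_tuple mu) ab) tP.
  rewrite (@tiles2_column _ _ (half_gap nu mu) _ _ _ _ tP) ?size_mkseq.
  - by rewrite expr0n (negbTE g0) mulr0.
  - by move=> x xN; rewrite -(half_gapE (size_tuple mu)) //; apply: ht_le.
  exact: skewS_layered (size_tuple mu) bnu ab.
apply: eq_big => [mu|mu /andP[dm ab]]; first by rewrite andbC.
apply: eq_big => [P|P]; have [e1 e2] := dyck_tilingE P (size_tuple mu) ab dm; first exact: e1.
by rewrite e1 => /e2[-> ->]; rewrite expr0 mulr1.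
Qed.

End DyckTilings.

Lemma dyck_completion lam : ballot lam -> dyck (lam ++ nseq (final_height lam) false).
Proof.
move=> bl; have fh : (count id lam = count negb lam + final_height lam)%N.
  have := ballot_height bl (leqnn _); rewrite /height /ht /final_height take_size; lia.
apply/andP; split.
  apply/forallP => -[x /=]; rewrite ltnS size_cat size_nseq -leq_subLR => le.
  rewrite /height take_cat; case: ltnP => xs.
    by have := ballot_height bl (ltnW xs); rewrite /height => ->.
  by rewrite take_nseq // !count_cat !count_nseq /=; lia.
by rewrite /height take_size !count_cat !count_nseq /=; apply/eqP; lia.
Qed.

Local Open Scope ring_scope.

Theorem mainTheorem3 (R : comPzRingType) (q t : R) (lam : seq bool) :
  ballot lam ->
  P_III q t lam =
  P_Dyck q (lam ++ nseq (final_height lam) false) *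
  \prod_(i < n_D lam) (1 + q ^+ i * t).
Proof.
move=> bl; have dl := dyck_completion bl.
rewrite P_Dyck_P_III // !P_III_chains //; last by case/andP: dl.
(* At t = 0 the product belonging to the completed path is 1, and its trailing D steps leave
   [chains] unchanged. *)
rewrite chains_cat_nseq [X in _ * X * _]big1 ?mulr1 // => i _.
by rewrite mulr0 addr0.
Qed.
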